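(* Let $(X,d)$ be a compact metric space, $T:X\to X$ a continuous map, $\Phi=\{\varphi_n:X\to\mathbb{R}\}_{n\in\mathbb{N}}$ a sequence of continuous functions, and $Z$ a non-empty compact subset of $X$. Assume that $\Phi$ satisfies the tempered distortion condition $$\lim_{\varepsilon\to 0}\limsup_{n\to\infty}\frac{\varphi_n(\varepsilon)}{n}=0,\qquad\text{where } \varphi_n(\varepsilon)=\sup\{|\varphi_n(x)-\varphi_n(y)|: x\in X,\ y\in B_n(x,e^{-n\varepsilon})\}.$$ Then $$P^{\tilde B}_Z(T,\Phi)=\lim_{\varepsilon\to 0}\sup\{\underline{P}^{\widetilde{BK}}_\mu(T,\Phi,\varepsilon):\mu\in M(X),\ \mu(Z)=1\}=\lim_{\varepsilon\to 0}\sup\{P^{\widetilde K}_\mu(T,\Phi,\varepsilon):\mu\in M(X),\ \mu(Z)=1\}.$$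
   Context: $M(X)$ is the set of Borel probability measures on $X$. For $n\in\mathbb{N}$, $x\in X$, $\varepsilon>0$, the neutralized Bowen ball is $B_n(x,e^{-n\varepsilon})=\{y\in X: d(T^jx,T^jy)<e^{-n\varepsilon}\ \forall\, 0\le j\le n-1\}$. Neutralized Bowen pressure: for $Z\subset X$, $\varepsilon>0$, $N\in\mathbb{N}$, $s\in\mathbb{R}$, let $M^s_{N,\varepsilon}(Z,\Phi)=\inf\sum_{i\in I}\exp[-n_is+\sup_{y\in B_{n_i}(x_i,e^{-n_i\varepsilon})}\varphi_{n_i}(y)]$, the infimum over all finite or countable covers $\{B_{n_i}(x_i,e^{-n_i\varepsilon})\}_{i\in I}$ of $Z$ with $n_i\ge N$, $x_i\in X$. Let $M^s_\varepsilon(Z,\Phi)=\lim_{N\to\infty}M^s_{N,\varepsilon}(Z,\Phi)$, $M_\varepsilon(Z,\Phi)=\inf\{s:M^s_\varepsilon(Z,\Phi)=0\}=\sup\{s:M^s_\varepsilon(Z,\Phi)=\infty\}$, and $P^{\tilde B}_Z(T,\Phi)=\lim_{\varepsilon\to0}M_\varepsilon(Z,\Phi)$. Lower neutralized Brin–Katok local pressure at scale $\varepsilon$: for $\mu\in M(X)$, $\underline{P}^{\widetilde{BK}}_\mu(T,\Phi,\varepsilon,x)=\liminf_{n\to\infty}\frac{-\log\mu(B_n(x,e^{-n\varepsilon}))+\varphi_n(x)}{n}$ and $\underline{P}^{\widetilde{BK}}_\mu(T,\Phi,\varepsilon)=\int\underline{P}^{\widetilde{BK}}_\mu(T,\Phi,\varepsilon,x)\,d\mu(x)$.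 Neutralized Katok pressure at scale $\varepsilon$: for $\mu\in M(X)$, $\delta\in(0,1)$, let $\Lambda^s_{N,\varepsilon}(\mu,\Phi,\delta)=\inf\sum_{i\in I}\exp[-n_is+\sup_{y\in B_{n_i}(x_i,e^{-n_i\varepsilon})}\varphi_{n_i}(y)]$, the infimum over all finite or countable families $\{B_{n_i}(x_i,e^{-n_i\varepsilon})\}_{i\in I}$ with $n_i\ge N$, $x_i\in X$ and $\mu(\bigcup_iB_{n_i}(x_i,e^{-n_i\varepsilon}))>1-\delta$; $\Lambda^s_\varepsilon(\mu,\Phi,\delta)=\lim_{N\to\infty}\Lambda^s_{N,\varepsilon}(\mu,\Phi,\delta)$; $\Lambda_\varepsilon(\mu,\Phi,\delta)=\inf\{s:\Lambda^s_\varepsilon(\mu,\Phi,\delta)=0\}=\sup\{s:\Lambda^s_\varepsilon(\mu,\Phi,\delta)=\infty\}$; and $P^{\widetilde K}_\mu(T,\Phi,\varepsilon)=\lim_{\delta\to0}\Lambda_\varepsilon(\mu,\Phi,\delta)$. *)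

(* Defs.v *)
From HB Require Import structures.
From mathcomp Require Import all_boot all_order all_algebra.
From mathcomp Require Import all_classical all_reals all_analysis.
Set Implicit Arguments. Unset Strict Implicit. Unset Printing Implicit Defensive.
Import Order.TTheory GRing.Theory Num.Theory.
Import numFieldNormedType.Exports.
Local Open Scope classical_set_scope.
Local Open Scope ring_scope.

Definition is_metric {R : realType} {X : Type} (dist : X -> X -> R) : Prop :=
  (forall x y, 0 <= dist x y) /\
  (forall x y, dist x y = 0 <-> x = y) /\
  (forall x y, dist x y = dist y x) /\
  (forall x y z, dist x z <= dist x y + dist y z).

Definition dopen {R : realType} {X : Type} (dist : X -> X -> R) (A : set X) : Prop :=
  forall x, A x -> exists2 r : R, 0 < r & [set y | dist x y < r] `<=` A.

Definition dcompact {R : realType} {X : Type} (dist : X -> X -> R) (K : set X) : Prop :=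
  forall (I : Type) (U : I -> set X),
    (forall i, dopen dist (U i)) -> K `<=` \bigcup_(i in setT) U i ->
    exists2 F : set I, finite_set F & K `<=` \bigcup_(i in F) U i.

Definition dcontinuous {R : realType} {X : Type} (dist : X -> X -> R) (T : X -> X) : Prop :=
  forall x (e : R), 0 < e -> exists2 del : R, 0 < del &
    forall y, dist x y < del -> dist (T x) (T y) < e.

Definition dcontinuous_real {R : realType} {X : Type} (dist : X -> X -> R) (f : X -> R) : Prop :=
  forall x (e : R), 0 < e -> exists2 del : R, 0 < del &
    forall y, dist x y < del -> `|f x - f y| < e.

Definition borel_for {R : realType} {d : measure_display} {X : measurableType d}
  (dist : X -> X -> R) : Prop :=
  (@measurable d X : set (set X)) = <<s [set A | dopen dist A] >>.

Definition bowen {R : realType} {X : Type} (dist : X -> X -> R) (T : X -> X)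
  (n : nat) (x : X) (r : R) : set X :=
  [set y | forall j, (j < n)%N -> dist (iter j T x) (iter j T y) < r].

Definition nball {R : realType} {X : Type} (dist : X -> X -> R) (T : X -> X)
  (n : nat) (x : X) (eps : R) : set X :=
  bowen dist T n x (expR (- (n%:R * eps))).

Local Open Scope ereal_scope.

Definition supphi {R : realType} {X : Type} (dist : X -> X -> R) (T : X -> X)
  (Phi : nat -> X -> R) (n : nat) (x : X) (eps : R) : \bar R :=
  ereal_sup [set (Phi n y)%:E | y in nball dist T n x eps].

Definition cterm {R : realType} {X : Type} (dist : X -> X -> R) (T : X -> X)
  (Phi : nat -> X -> R) (s : R) (n : nat) (x : X) (eps : R) : \bar R :=
  expeR ((- (n%:R * s))%:E + supphi dist T Phi n x eps).

(* families indexed by I : set nat cover all finite or countable families *)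

Definition MNs {R : realType} {X : Type} (dist : X -> X -> R) (T : X -> X)
  (Phi : nat -> X -> R) (Z : set X) (N : nat) (eps s : R) : \bar R :=
  ereal_inf [set v | exists (I : set nat) (n : nat -> nat) (x : nat -> X),
     [/\ (forall i, I i -> (N <= n i)%N),
         Z `<=` \bigcup_(i in I) nball dist T (n i) (x i) eps &
         v = \esum_(i in I) cterm dist T Phi s (n i) (x i) eps]].

Definition Ms {R : realType} {X : Type} (dist : X -> X -> R) (T : X -> X)
  (Phi : nat -> X -> R) (Z : set X) (eps s : R) : \bar R :=
  limn (fun N => MNs dist T Phi Z N eps s).

Definition Mcrit {R : realType} {X : Type} (dist : X -> X -> R) (T : X -> X)
  (Phi : nat -> X -> R) (Z : set X) (eps : R) : \bar R :=
  ereal_inf [set s%:E | s in [set s : R | Ms dist T Phi Z eps s = 0]].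

Definition PB {R : realType} {X : Type} (dist : X -> X -> R) (T : X -> X)
  (Phi : nat -> X -> R) (Z : set X) : \bar R :=
  lim (Mcrit dist T Phi Z @ 0^'+).

Definition lowerBK_at {R : realType} {d : measure_display} {X : measurableType d}
  (dist : X -> X -> R) (T : X -> X) (Phi : nat -> X -> R)
  (mu : {measure set X -> \bar R}) (eps : R) (x : X) : \bar R :=
  limn_einf (fun n : nat =>
    (- lne (mu (nball dist T n x eps)) + (Phi n x)%:E) * ((n%:R)^-1)%:E).

Definition lowerBK {R : realType} {d : measure_display} {X : measurableType d}
  (dist : X -> X -> R) (T : X -> X) (Phi : nat -> X -> R)
  (mu : {measure set X -> \bar R}) (eps : R) : \bar R :=
  \int[mu]_x lowerBK_at dist T Phi mu eps x.

Definition LNs {R : realType} {d : measure_display} {X : measurableType d}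
  (dist : X -> X -> R) (T : X -> X) (Phi : nat -> X -> R)
  (mu : {measure set X -> \bar R}) (delta : R) (N : nat) (eps s : R) : \bar R :=
  ereal_inf [set v | exists (I : set nat) (n : nat -> nat) (x : nat -> X),
     [/\ (forall i, I i -> (N <= n i)%N),
         (1 - delta)%:E < mu (\bigcup_(i in I) nball dist T (n i) (x i) eps) &
         v = \esum_(i in I) cterm dist T Phi s (n i) (x i) eps]].

Definition Ls {R : realType} {d : measure_display} {X : measurableType d}
  (dist : X -> X -> R) (T : X -> X) (Phi : nat -> X -> R)
  (mu : {measure set X -> \bar R}) (delta eps s : R) : \bar R :=
  limn (fun N => LNs dist T Phi mu delta N eps s).

Definition Lcrit {R : realType} {d : measure_display} {X : measurableType d}
  (dist : X -> X -> R) (T : X -> X) (Phi : nat -> X -> R)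
  (mu : {measure set X -> \bar R}) (eps delta : R) : \bar R :=
  ereal_inf [set s%:E | s in [set s : R | Ls dist T Phi mu delta eps s = 0]].

Definition PK {R : realType} {d : measure_display} {X : measurableType d}
  (dist : X -> X -> R) (T : X -> X) (Phi : nat -> X -> R)
  (mu : {measure set X -> \bar R}) (eps : R) : \bar R :=
  lim (Lcrit dist T Phi mu eps @ 0^'+).

Definition distortion {R : realType} {X : Type} (dist : X -> X -> R) (T : X -> X)
  (Phi : nat -> X -> R) (n : nat) (eps : R) : \bar R :=
  ereal_sup [set v | exists x y, nball dist T n x eps y /\ v = (`|Phi n x - Phi n y|)%:E].

Definition tempered_distortion {R : realType} {X : Type} (dist : X -> X -> R)
  (T : X -> X) (Phi : nat -> X -> R) : Prop :=
  (fun eps : R => limn_esup (fun n : nat => distortion dist T Phi n eps * ((n%:R)^-1)%:E))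
    @ 0^'+ --> 0.

(* Main.v *)
Require Import Defs.
From HB Require Import structures.
From mathcomp Require Import all_boot all_order all_algebra.
From mathcomp Require Import all_classical all_reals all_analysis.
From mathcomp Require Import measurable_realfun.
From mathcomp Require Import ring lra zify.
Import Order.TTheory GRing.Theory Num.Theory.
Import numFieldNormedType.Exports.
Set Implicit Arguments. Unset Strict Implicit. Unset Printing Implicit Defensive.
Local Open Scope classical_set_scope.
Local Open Scope ring_scope.

(** Write [L] for the infimum over [e > 0] of the critical values [Mcrit Z e].
    Passing from scale [e2] to a smaller scale [e1] keeps every cover a cover and,
    by tempered distortion, raises the cost exponent by an arbitrarily small [del];
    hence [Mcrit Z e] tends to [L], which is therefore the pressure [PB].

    Upper bounds. The Katok pressure of [mu] at scale [e] is at most [Mcrit Z e]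
    because a cover of [Z] has full measure. The local pressure at scale [e / 2] is
    at most [Mcrit Z e] by the mass distribution principle.

    Lower bounds. If [s + 2 del < Mcrit Z (e / 2)], fractional covers of [Z] by
    neutralized balls of scale [e] have cost bounded below. Hahn-Banach, applied to
    the optimal fractional covering cost of a bounded function, then gives a finitely
    additive probability, carried by [Z], of all subsets of [X] for which the measure
    of a ball of length [n] is at most a constant times its cost. A finitely additive
    probability on a compact metric space is turned into a Borel one without
    increasing the measure of open sets. The resulting measure has both local and
    Katok pressure at scale [e] at least [s], up to [del]. *)

(** * Hahn-Banach *)

Section hahn_banach.
Context {R : realType} {V : lmodType R}.
Implicit Types p q : V -> R.

(** Homogeneity is only an inequality here, which makes it stable under infima; applying it to the
    inverse scalar as well recovers equality in [sublinearZ]. *)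
Definition sublinear p :=
  (forall x y, p (x + y) <= p x + p y) /\
  (forall t x, 0 <= t -> p (t *: x) <= t * p x).

Lemma sublinear0 p : sublinear p -> p 0 = 0.
Proof.
move=> [pD pZ]; apply/eqP; rewrite eq_le; apply/andP; split.
  by have := pZ 0 0 (lexx _); rewrite scale0r mul0r.
by have := pD 0 0; rewrite addr0; lra.
Qed.

Lemma sublinearZ p t x : sublinear p -> 0 <= t -> p (t *: x) = t * p x.
Proof.
move=> sp t0; have [_ pZ] := sp.
apply/eqP; rewrite eq_le pZ//=.
have [->|tn0] := eqVneq t 0; first by rewrite scale0r mul0r sublinear0.
have tp : 0 < t by rewrite lt_def tn0.
have := pZ t^-1 (t *: x); rewrite invr_ge0 => /(_ t0).
by rewrite scalerA mulVf// scale1r mulrC ler_pdivlMr// mulrC.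
Qed.

Lemma sublinearN p x : sublinear p -> - p (- x) <= p x.
Proof.
move=> sp; have [pD _] := sp.
by have := pD x (- x); rewrite subrr sublinear0//; lra.
Qed.

(* A linear functional below [tilt p v] takes the value [p v] at [v]. *)
Definition tilt p v (x : V) : R :=
  inf [set p (x + t *: v) - t * p v | t in [set t | 0 <= t]].

Lemma tilt_lb p v x t : sublinear p -> 0 <= t ->
  - p (- x) <= p (x + t *: v) - t * p v.
Proof.
move=> sp t0; have [pD _] := sp.
have := pD (x + t *: v) (- x).
by rewrite addrAC subrr add0r sublinearZ//; lra.
Qed.

Lemma tilt_le p v x t : sublinear p -> 0 <= t ->
  tilt p v x <= p (x + t *: v) - t * p v.
Proof.
move=> sp t0; apply: ge_inf; last by exists t.
by exists (- p (- x)) => _ [u u0 <-]; exact: tilt_lb.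
Qed.

Lemma le_tilt p v x c : 
  (forall t, 0 <= t -> c <= p (x + t *: v) - t * p v) -> c <= tilt p v x.
Proof.
move=> h; apply: lb_le_inf; last by move=> _ [t t0 <-]; exact: h.
by exists (p (x + 0 *: v) - 0 * p v); exists 0 => //=.
Qed.

(** Parameters [t] for [x] and [u] for [y] combine into the admissible parameter [t + u] for
    [x + y]; for homogeneity the parameter is rescaled together with the vector. *)
Lemma tilt_sublinear p v : sublinear p -> sublinear (tilt p v).
Proof.
move=> sp; have [pD pZ] := sp; split=> [x y|a x a0].
  rewrite -lerBlDl; apply: le_tilt => u u0.
  rewrite lerBlDl -lerBlDr; apply: le_tilt => t t0.
  rewrite lerBlDr; apply: le_trans (tilt_le v _ sp (addr_ge0 t0 u0)) _.
  have := pD (x + t *: v) (y + u *: v).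
  by rewrite scalerDl [x + y + _]addrACA; lra.
have [->|an0] := eqVneq a 0.
  rewrite scale0r mul0r; apply: le_trans (tilt_le v _ sp (lexx _)) _.
  by rewrite scale0r addr0 sublinear0// mul0r subr0.
have ap : 0 < a by rewrite lt_def an0.
rewrite -ler_pdivrMl//; apply: le_tilt => t t0.
rewrite ler_pdivrMl//; apply: le_trans (tilt_le v _ sp (mulr_ge0 a0 t0)) _.
by rewrite -scalerA -scalerDr mulrBr mulrA lerD2r pZ.
Qed.

Lemma tilt_le_id p v x : sublinear p -> tilt p v x <= p x.
Proof.
by move=> sp; have := tilt_le v x sp (lexx 0); rewrite scale0r addr0 mul0r subr0.
Qed.

Lemma tiltN p v : sublinear p -> tilt p v (- v) <= - p v.
Proof.
move=> sp; have := tilt_le v (- v) sp ler01.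
by rewrite scale1r addNr sublinear0// mul1r sub0r.
Qed.

(** Zorn's lemma, with the pointwise infimum as lower bound of a chain. The infimum is finite
    because every member is at least [- p (- x)], and it is subadditive because of any two members
    of a chain one lies below the other. *)
Lemma sublinear_minimal p : sublinear p -> exists q,
  [/\ sublinear q, (forall x, q x <= p x) &
      forall q', sublinear q' -> (forall x, q' x <= q x) -> forall x, q x <= q' x].
Proof.
move=> sp.
pose S := {q : V -> R | sublinear q /\ forall x, q x <= p x}.
pose ord (a b : S) := `[< forall x, sval b x <= sval a x >].
have [||| [q [sq qp]] qmin] := @ZL_preorder S (exist _ p (conj sp (fun=> lexx _))) ord.
- by move=> a; apply/asboolP => x.
- move=> a b c /asboolP ba /asboolP ac; apply/asboolP => x.
  exact: le_trans (ac x) (ba x).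
- move=> A tot.
  have [[a0 Aa0]|A0] := pselect (exists a, A a); last first.
    exists (exist _ p (conj sp (fun=> lexx _))) => a Aa.
    by exfalso; apply: A0; exists a.
  pose q x := inf [set sval a x | a in A].
  have lbq (a : S) x : - p (- x) <= sval a x.
    have [sa ap] := svalP a.
    by apply: le_trans (sublinearN x sa); rewrite lerN2.
  have q_le a x : A a -> q x <= sval a x.
    move=> Aa; apply: ge_inf; last by exists a.
    by exists (- p (- x)) => _ [b Ab <-].
  have le_q c x : (forall a, A a -> c <= sval a x) -> c <= q x.
    move=> h; apply: lb_le_inf; first by exists (sval a0 x); exists a0.
    by move=> _ [b Ab <-]; exact: h.
  have sq : sublinear q.
    split=> [x y|t x t0].
      rewrite -lerBlDl; apply: (le_q _ _) => b Ab.
      rewrite lerBlDl -lerBlDr; apply: (le_q _ _) => a Aa.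
      rewrite lerBlDr.
      have [/asboolP ab|/asboolP ab] := tot a b Aa Ab.
        have [[bD _] _] := svalP b.
        apply: le_trans (q_le b _ Ab) _; apply: le_trans (bD _ _) _.
        by have := ab x; lra.
      have [[aD _] _] := svalP a.
      apply: le_trans (q_le a _ Aa) _; apply: le_trans (aD _ _) _.
      by have := ab y; lra.
    have [->|tn0] := eqVneq t 0.
      rewrite scale0r mul0r; apply: le_trans (q_le a0 _ Aa0) _.
      by rewrite sublinear0//; case: (svalP a0).
    have tp : 0 < t by rewrite lt_def tn0.
    rewrite -ler_pdivrMl//; apply: (le_q _ _) => a Aa; rewrite ler_pdivrMl//.
    apply: le_trans (q_le a _ Aa) _.
    by have [[_ aZ] _] := svalP a; exact: aZ.
  have qp x : q x <= p x.
    by apply: le_trans (q_le a0 _ Aa0) _; case: (svalP a0).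
  exists (exist _ q (conj sq qp)) => a Aa; apply/asboolP => x /=.
  exact: q_le.
exists q; split=> // q' sq' q'q.
have q'p x : q' x <= p x by exact: le_trans (q'q x) (qp x).
have := qmin (exist _ q' (conj sq' q'p)).
move=> h; have /asboolP : ord (exist _ q' (conj sq' q'p))
    (exist (fun q : V -> R => sublinear q /\ (forall x : V, q x <= p x)) q (conj sq qp)).
  by apply: h; apply/asboolP.
by [].
Qed.

(** A minimal sublinear functional [q] is linear: compared with its own tilt along [x], minimality
    yields [q (- x) <= - q x], so [q] is odd and hence additive. Taking [q] below [tilt p v] fixes
    its value at [v]. *)
Theorem hahn_banach p v : sublinear p -> exists L : {scalar V},
  (forall x, L x <= p x) /\ L v = p v.
Proof.
move=> sp; have [q [sq qp qmin]] := sublinear_minimal (tilt_sublinear v sp).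
have qN x : q (- x) = - q x.
  apply/eqP; rewrite eq_le; apply/andP; split.
    have := qmin _ (tilt_sublinear x sq) (fun y => tilt_le_id x y sq) (- x).
    by move=> /le_trans; apply; exact: tiltN.
  by rewrite lerNl sublinearN.
have qD x y : q (x + y) = q x + q y.
  apply/eqP; rewrite eq_le sq.1/=.
  have := sq.1 (- x) (- y); rewrite -opprD !qN; lra.
have qlin : linear_for *%R q.
  move=> a x y; rewrite qD; congr (_ + _).
  have [a0|a0] := leP 0 a; first exact: sublinearZ.
  by rewrite -[a in LHS]opprK scaleNr qN sublinearZ ?oppr_ge0 1?ltW// mulNr opprK.
pose L : {scalar V} := HB.pack q (GRing.isLinear.Build R V R _ q qlin).
exists L; split=> [x|].
  by apply: le_trans (qp x) _; exact: tilt_le_id.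
apply/eqP; rewrite eq_le; apply/andP; split.
  by apply: le_trans (qp v) _; exact: tilt_le_id.
by have := le_trans (qp (- v)) (tiltN v sp); rewrite qN lerN2.
Qed.

End hahn_banach.

(** * Duality for fractional covers *)

Section bounded_functions.
Context {R : realType} {X : Type}.

(** No measurability is imposed, so indicators of arbitrary subsets belong to the space and the dual
    functional yields a set function on all subsets. *)
Definition bddfun : {pred X -> R} :=
  [pred f | `[< exists M, forall x, `|f x| <= M >]].

Lemma bddfun_submod_closed : submod_closed bddfun.
Proof.
split; first by apply/asboolP; exists 0 => x; rewrite normr0.
move=> a f g /asboolP[M fM] /asboolP[N gN]; apply/asboolP.
exists (`|a| * M + N) => x; apply: le_trans (ler_normD _ _) _.
by rewrite lerD// normrM ler_wpM2l.
Qed.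

HB.instance Definition _ :=
  GRing.isSubmodClosed.Build R (X -> R) bddfun bddfun_submod_closed.

Record bfun := BFun { bfun_val :> X -> R; _ : bfun_val \in bddfun }.
HB.instance Definition _ := [isSub for bfun_val].
HB.instance Definition _ := [Choice of bfun by <:].
HB.instance Definition _ := [SubChoice_isSubLmodule of bfun by <:].

Lemma bfunD (f g : bfun) x : (f + g) x = f x + g x.
Proof. by []. Qed.

Lemma bfunZ a (f : bfun) x : (a *: f) x = a * f x.
Proof. by []. Qed.

Lemma bfunN (f : bfun) x : (- f) x = - f x.
Proof. by []. Qed.

Lemma bfunP (f : bfun) : exists M, forall x, `|f x| <= M.
Proof. by case: f => f /= /asboolP. Qed.

Lemma indic_bddfun (A : set X) : (\1_A : X -> R) \in bddfun.
Proof.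
by apply/asboolP; exists 1 => x; rewrite indicE normr_nat lern1 leq_b1.
Qed.

Definition bindic A := BFun (indic_bddfun A).

Lemma bindicE A x : bindic A x = (x \in A)%:R.
Proof. by rewrite /bindic /= indicE. Qed.

Lemma bfun_eqP (f g : bfun) : (forall x, f x = g x) -> f = g.
Proof. by move=> fg; apply/val_inj/funext. Qed.

End bounded_functions.

Section weighted_covers.
Context {R : realType} {X I : Type} (B : I -> set X) (a : I -> R).
Implicit Types F : seq (R * I).

(** A fractional family is a finite list of pairs of a weight and an index. Repeated indices are
    allowed, so that concatenation adds both costs and weights. *)
Definition wpos F := all (fun w => 0 <= w.1) F.
Definition wcost F : R := \sum_(w <- F) w.1 * a w.2.
Definition weight F (x : X) : R := \sum_(w <- F) w.1 * \1_(B w.2) x.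
Definition wscale (t : R) F := [seq (t * w.1, w.2) | w <- F].

Lemma wcost_cat F G : wcost (F ++ G) = wcost F + wcost G.
Proof. by rewrite /wcost big_cat. Qed.

Lemma weight_cat F G x : weight (F ++ G) x = weight F x + weight G x.
Proof. by rewrite /weight big_cat. Qed.

Lemma wpos_cat F G : wpos (F ++ G) = wpos F && wpos G.
Proof. exact: all_cat. Qed.

Lemma wcost_scale t F : wcost (wscale t F) = t * wcost F.
Proof.
by rewrite /wcost big_map mulr_sumr; apply: eq_bigr => w _; rewrite mulrA.
Qed.

Lemma weight_scale t F x : weight (wscale t F) x = t * weight F x.
Proof.
by rewrite /weight big_map mulr_sumr; apply: eq_bigr => w _; rewrite mulrA.
Qed.

Lemma wpos_scale t F : 0 <= t -> wpos F -> wpos (wscale t F).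
Proof.
move=> t0 F0; rewrite /wpos all_map; apply: sub_all F0 => w /= w0.
exact: mulr_ge0.
Qed.

Hypothesis a_ge0 : forall i, 0 <= a i.

Lemma wcost_ge0 F : wpos F -> 0 <= wcost F.
Proof.
rewrite /wcost; elim: F => [|w F IH] /=; first by rewrite big_nil.
by case/andP=> w0 /IH F0; rewrite big_cons addr_ge0// mulr_ge0.
Qed.

Variables (Z : set X) (F0 : seq (R * I)).
Hypotheses (F0pos : wpos F0) (F0cov : forall z, Z z -> 1 <= weight F0 z).

(** The costs are bounded below by 0, and [F0] rescaled by a bound of [f] is admissible, so this
    [inf] is a genuine infimum. Domination on [Z] alone is what places the dual content on [Z]. *)
Definition wfunctional (f : @bfun R X) : R := inf [set wcost F | F in
  [set F | wpos F /\ forall z, Z z -> f z <= weight F z]].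

Lemma wfunctional_le (f : @bfun R X) F : wpos F ->
  (forall z, Z z -> f z <= weight F z) -> wfunctional f <= wcost F.
Proof.
move=> Fp Ff; apply: ge_inf; last by exists F.
by exists 0 => _ [G [Gp _] <-]; exact: wcost_ge0.
Qed.

Lemma le_wfunctional (f : @bfun R X) c :
  (forall F, wpos F -> (forall z, Z z -> f z <= weight F z) -> c <= wcost F) ->
  c <= wfunctional f.
Proof.
move=> h; apply: lb_le_inf; last by move=> _ [F [Fp Ff] <-]; exact: h.
have [M fM] := bfunP f.
exists (wcost (wscale `|M| F0)); exists (wscale `|M| F0) => //=; split.
  exact: wpos_scale.
move=> z Zz; rewrite weight_scale.
have fMz : f z <= `|M|.
  by rewrite (le_trans (ler_norm _))// (le_trans (fM z))// ler_norm.
by rewrite (le_trans fMz)// ler_peMr// F0cov.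
Qed.

Lemma wfunctional_sublinear : sublinear wfunctional.
Proof.
split=> [f g|t f t0].
  rewrite -lerBlDl; apply: le_wfunctional => G Gp Gg.
  rewrite lerBlDl -lerBlDr; apply: le_wfunctional => F Fp Ff.
  rewrite lerBlDr -wcost_cat; apply: wfunctional_le => [|z Zz].
    by rewrite wpos_cat Fp.
  by rewrite weight_cat bfunD lerD ?Ff ?Gg.
have [->|tn0] := eqVneq t 0.
  rewrite scale0r mul0r; apply: le_trans (wfunctional_le (F := [::]) _ _) _ => //.
  - by move=> z _; rewrite /weight big_nil.
  - by rewrite /wcost big_nil.
have tp : 0 < t by rewrite lt_def tn0.
rewrite -ler_pdivrMl//; apply: le_wfunctional => F Fp Ff.
rewrite ler_pdivrMl// -wcost_scale; apply: wfunctional_le => [|z Zz].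
  exact: wpos_scale.
by rewrite weight_scale bfunZ ler_pM2l// Ff.
Qed.

(* The linear functional is automatically positive and vanishes on functions
   supported off [Z], since those that are nonpositive on [Z] have cost at most 0. *)
Theorem weighted_cover_duality (k : R) : 0 < k ->
  (forall F, wpos F -> (forall z, Z z -> 1 <= weight F z) -> k <= wcost F) ->
  exists m : set X -> R,
    [/\ forall A, 0 <= m A,
        forall A A', A `&` A' = set0 -> m (A `|` A') = m A + m A',
        m Z = 1, m setT = 1 &
        forall i, m (B i) <= k^-1 * a i].
Proof.
move=> k0 kle; pose e := @bindic R X setT.
have ke : k <= wfunctional e.
  apply: le_wfunctional => F Fp Ff; apply: kle => // z Zz.
  by have := Ff z Zz; rewrite bindicE in_setT.
have [L [Lle Le]] := hahn_banach e wfunctional_sublinear.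
have c0 : 0 < L e by rewrite Le (lt_le_trans k0).
have Lnil (f : @bfun R X) : (forall z, Z z -> f z <= 0) -> L f <= 0.
  move=> f0; apply: le_trans (Lle f) _.
  apply: le_trans (wfunctional_le (F := [::]) _ _) _ => //.
  - by move=> z Zz; rewrite /weight big_nil f0.
  - by rewrite /wcost big_nil.
have Lge0 A : 0 <= L (bindic A).
  rewrite -oppr_le0 -raddfN; apply: Lnil => z _.
  by rewrite bfunN bindicE oppr_le0 ler0n.
have LU A A' : A `&` A' = set0 ->
    L (bindic (A `|` A')) = L (bindic A) + L (bindic A').
  move=> AA'; rewrite -raddfD; congr (L _); apply: bfun_eqP => x.
  rewrite bfunD !bindicE in_setU.
  case: (boolP (x \in A)); case: (boolP (x \in A')); rewrite ?addr0 ?add0r//.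
  move=> /set_mem A'x /set_mem Ax.
  by have : (A `&` A') x by []; rewrite AA'.
have LZ : L (bindic Z) = L e.
  have -> : e = bindic (Z `|` ~` Z) by rewrite setUv.
  rewrite LU ?setICr//.
  suff -> : L (bindic (~` Z)) = 0 by rewrite addr0.
  apply/eqP; rewrite eq_le Lge0 andbT; apply: Lnil => z Zz.
  by rewrite bindicE memNset.
(* Normalizing by [L e], which is at least [k], produces the factor [k^-1] in the bound on balls. *)
exists (fun A => L (bindic A) / L e); split=> [A|A A' AA'|||i].
- by rewrite divr_ge0// ltW.
- by rewrite LU// mulrDl.
- by rewrite LZ divff ?gt_eqF.
- by rewrite divff ?gt_eqF.
- have Bi : L (bindic (B i)) <= a i.
    apply: le_trans (Lle _) _.
    have -> : a i = wcost [:: (1, i)] by rewrite /wcost big_seq1 mul1r.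
    apply: wfunctional_le => [|z _]; first by rewrite /wpos /= ler01.
    by rewrite /weight big_seq1 mul1r.
  rewrite mulrC; apply: ler_pM => //; first by rewrite invr_ge0 ltW.
  by rewrite lef_pV2 ?posrE// Le.
Qed.

End weighted_covers.

(** * From finitely additive to Borel probabilities *)

Definition shrink {R : realType} {X : Type} (dist : X -> X -> R) (U : set X) (r : R) :
    set X :=
  [set x | forall y, dist x y < r -> U y].

Section metric.
Context {R : realType} {X : Type} {dist : X -> X -> R}.
Hypothesis metricX : is_metric dist.

Lemma dist_ge0 x y : 0 <= dist x y. Proof. by case: metricX. Qed.

Lemma distxx x : dist x x = 0.
Proof. by case: metricX => _ [/(_ x x)[_]] h _; apply: h. Qed.

Lemma dist_sym x y : dist x y = dist y x.
Proof. by case: metricX => _ [_ []]. Qed.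

Lemma dist_tri x y z : dist x z <= dist x y + dist y z.
Proof. by case: metricX => _ [_ []]. Qed.

Lemma dopen_ball x r : dopen dist [set y | dist x y < r].
Proof.
move=> y /= xy; exists (r - dist x y); first by rewrite subr_gt0.
by move=> z /= yz; have := dist_tri x y z; lra.
Qed.

Lemma dopenT : dopen dist setT.
Proof. by move=> x _; exists 1. Qed.

Lemma dopen0 : dopen dist set0.
Proof. by []. Qed.

Lemma dopenI A B : dopen dist A -> dopen dist B -> dopen dist (A `&` B).
Proof.
move=> oA oB x [/oA[r r0 rA] /oB[s s0 sB]].
exists (Num.min r s); first by rewrite lt_min r0.
by move=> y /=; rewrite lt_min => /andP[xr xs]; split; [exact: rA|exact: sB].
Qed.

Lemma dopen_bigcup (I : Type) (D : set I) (A : I -> set X) :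
  (forall i, D i -> dopen dist (A i)) -> dopen dist (\bigcup_(i in D) A i).
Proof.
move=> oA x [i Di Aix]; have [r r0 rA] := oA i Di x Aix.
by exists r => // y xy; exists i => //; exact: rA.
Qed.

Lemma shrink_sub U r : 0 < r -> shrink dist U r `<=` U.
Proof. by move=> r0 x; apply; rewrite distxx. Qed.

Lemma shrinkS U V r s : U `<=` V -> s <= r -> shrink dist U r `<=` shrink dist V s.
Proof. by move=> UV sr x Ux y xy; apply/UV/Ux/(lt_le_trans xy). Qed.

End metric.

(** The common last step of the compactness arguments: a finite subcover has a strict upper bound on
    its integer labels and a positive lower bound on its radii. *)
Lemma finite_bounds (R : realType) (J : choiceType) (F : set J) (i : J -> nat)
    (r : J -> R) : finite_set F -> (forall j, 0 < r j) ->
  exists N, exists2 s : R, 0 < s & forall j, F j -> (i j < N)%N /\ s <= r j.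
Proof.
move=> /finite_seqP[t ->] r0; elim: t => [|j t [N [s s0 h]]].
  by exists 0%N; exists 1.
exists (maxn N (i j).+1); exists (Num.min s (r j)).
  by rewrite lt_min s0 r0.
move=> k /=; rewrite inE => /orP[/eqP ->|kt].
  by split; [rewrite leq_maxr|rewrite ge_min lexx orbT].
have [iN sr] := h k kt; split; first by rewrite (leq_trans iN)// leq_maxl.
by rewrite ge_min sr.
Qed.

Section content.
Context {R : realType} {X : Type} (m : set X -> R).
Hypotheses (m_ge0 : forall A, 0 <= m A)
  (mU : forall A B, A `&` B = set0 -> m (A `|` B) = m A + m B).

Lemma content0 : m set0 = 0.
Proof. by have := mU (setI0 (set0 : set X)); rewrite setU0; lra. Qed.


Lemma contentD A B : A `<=` B -> m B = m A + m (B `\` A).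
Proof. by move=> AB; rewrite -mU ?setDIK// setDUK. Qed.

Lemma le_content A B : A `<=` B -> m A <= m B.
Proof. by move=> AB; rewrite (contentD AB) lerDl. Qed.

Lemma contentU_le A B : m (A `|` B) <= m A + m B.
Proof.
have -> : A `|` B = A `|` (B `\` A) by rewrite setUDr setDv setD0.
by rewrite mU ?setDIK// lerD2l; apply: le_content; exact: subDsetl.
Qed.

Lemma content_bigsetU_le (A : (set X)^nat) n :
  m (\big[setU/set0]_(i < n) A i) <= \sum_(i < n) m (A i).
Proof.
elim: n => [|n IH]; first by rewrite !big_ord0 content0.
by rewrite !big_ord_recr/= (le_trans (contentU_le _ _))// lerD2r.
Qed.

End content.

Local Open Scope ereal_scope.

Section outer_measure_of_content.
Context {R : realType} {X : choiceType} {dist : X -> X -> R}.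
Hypotheses (metricX : is_metric dist) (compactX : dcompact dist setT).
Variable m : set X -> R.
Hypotheses (m_ge0 : forall A, (0 <= m A)%R)
  (mU : forall A B, A `&` B = set0 -> (m (A `|` B) = m A + m B)%R).

Let le_m := le_content m_ge0 mU.

(** Measuring only shrunken copies of [U] discards the mass that [m] may concentrate at the boundary
    of [U]. This makes the result countably subadditive on open sets, although [m] is only finitely
    additive. *)
Definition inner_content (U : set X) : \bar R :=
  ereal_sup [set (m (shrink dist U r))%:E | r in [set r : R | (0 < r)%R]].

Lemma inner_content_ge U r : (0 < r)%R ->
  (m (shrink dist U r))%:E <= inner_content U.
Proof. by move=> r0; apply: ereal_sup_ubound; exists r. Qed.

Lemma inner_content_le U c : (forall r, (0 < r)%R ->
  (m (shrink dist U r))%:E <= c) -> inner_content U <= c.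
Proof. by move=> h; apply: ge_ereal_sup => _ [r r0 <-]; exact: h. Qed.

Lemma inner_content_le_content U : inner_content U <= (m U)%:E.
Proof.
by apply: inner_content_le => r r0; rewrite lee_fin le_m//; exact: shrink_sub.
Qed.

Lemma inner_content_ge0 U : 0 <= inner_content U.
Proof. by apply: le_trans (inner_content_ge U ltr01); rewrite lee_fin. Qed.

Lemma inner_content_fin_num U : inner_content U \is a fin_num.
Proof.
rewrite ge0_fin_numE ?inner_content_ge0//.
by rewrite (le_lt_trans (inner_content_le_content U))// ltry.
Qed.

(* The compactness argument behind countable subadditivity: a point at distance
   at least [r] from the complement of the union lies deep inside one of finitely
   many of the sets. *)
Lemma inner_content_sigma_subadditive (V : (set X)^nat) :
  (forall i, dopen dist (V i)) ->
  inner_content (\bigcup_i V i) <= \sum_(i <oo) inner_content (V i).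
Proof.
move=> oV; apply: inner_content_le => r r0.
(* The number [ir.2] is both the radius of the ball around [x] and the depth inside [V ir.1]; in the
   first alternative the index is a placeholder. *)
have /choice[f fP] : forall x, exists ir : nat * R, (0 < ir.2)%R /\
    ((forall y, (dist x y < ir.2)%R -> ~ shrink dist (\bigcup_i V i) r y) \/
     (forall y, (dist x y < ir.2)%R -> shrink dist (V ir.1) ir.2 y)).
  move=> x; have [[i _ Vix]|nVx] := pselect ((\bigcup_i V i) x); last first.
    exists (0%N, r); split => //; left => y /= xy Vy; apply: nVx.
    by apply: Vy; rewrite (dist_sym metricX).
  have [s s0 sV] := oV i x Vix.
  exists (i, s / 2)%R; split; first by rewrite /= divr_gt0.
  right => y /= xy z yz; apply: sV => /=.
  by have := dist_tri metricX x y z; lra.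
have [F finF FX] := compactX (fun x => dopen_ball metricX (x := x) (r := (f x).2))
  (fun x _ => ex_intro2 _ _ x I (let: conj h _ := fP x in
     eq_ind_r (fun t => is_true (t < _)%R) h (distxx metricX x))).
have [N [s s0 Ns]] := finite_bounds (fun x => (f x).1) finF (fun x => (fP x).1).
have sub : shrink dist (\bigcup_i V i) r `<=`
    \big[setU/set0]_(i < N) shrink dist (V i) s.
  move=> y Vy; have [x Fx /= xy] := FX y I.
  have [_ [h|h]] := fP x; first by have := h _ xy.
  have [iN sx] := Ns _ Fx.
  rewrite -(bigcup_mkord N (fun i => shrink dist (V i) s)).
  exists (f x).1 => //.
  exact: shrinkS (h _ xy).
apply: (@le_trans _ _ (\sum_(i < N) inner_content (V i))); last first.
  rewrite -(big_mkord xpredT (fun i => inner_content (V i))).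
  by apply: nneseries_lim_ge => i _ _; exact: inner_content_ge0.
apply: (@le_trans _ _ (\sum_(i < N) m (shrink dist (V i) s))%:E).
  rewrite lee_fin (le_trans (le_m sub))//.
  exact: (content_bigsetU_le m_ge0 mU (fun i => shrink dist (V i) s)).
by rewrite -sumEFin; apply: lee_sum => i _; exact: inner_content_ge.
Qed.

Definition content_outer (A : set X) : \bar R :=
  ereal_inf [set inner_content U | U in [set U | dopen dist U /\ A `<=` U]].

Lemma content_outer_le A U : dopen dist U -> A `<=` U ->
  content_outer A <= inner_content U.
Proof. by move=> oU AU; apply: ereal_inf_lbound; exists U. Qed.

Lemma le_content_outer A c :
  (forall U, dopen dist U -> A `<=` U -> c <= inner_content U) ->
  c <= content_outer A.
Proof. by move=> h; apply: le_ereal_inf_tmp => _ [U [oU AU] <-]; exact: h. Qed.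

Lemma content_outer_ge0 A : 0 <= content_outer A.
Proof. by apply: le_content_outer => U _ _; exact: inner_content_ge0. Qed.

Lemma content_outer_fin_num A : content_outer A \is a fin_num.
Proof.
rewrite ge0_fin_numE ?content_outer_ge0//.
apply: le_lt_trans (content_outer_le (dopenT (dist := dist)) _) _ => //.
by rewrite -ge0_fin_numE ?inner_content_ge0// inner_content_fin_num.
Qed.

Lemma content_outer0 : content_outer set0 = 0.
Proof.
apply/eqP; rewrite eq_le content_outer_ge0 andbT.
apply: le_trans (content_outer_le (dopen0 (dist := dist)) _) _ => //.
by apply: le_trans (inner_content_le_content _) _; rewrite (content0 mU).
Qed.

Lemma content_outer_mono A B : A `<=` B -> content_outer A <= content_outer B.
Proof.
move=> AB; apply: le_content_outer => U oU BU.
by apply: content_outer_le => //; exact: subset_trans BU.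
Qed.

Lemma content_outer_sigma_subadditive : sigma_subadditive content_outer.
Proof.
move=> A; apply/lee_addgt0Pr => e e0.
have /choice[U UP] : forall i, exists U, [/\ dopen dist U, A i `<=` U &
    inner_content U <= content_outer (A i) + (e / (2 ^ i.+1)%:R)%:E].
  move=> i; have e'0 : (0 < e / (2 ^ i.+1)%:R)%R.
    by rewrite divr_gt0// ltr0n expn_gt0.
  have [_ [U [oU AU] <-] h] := lb_ereal_inf_adherent e'0 (content_outer_fin_num (A i)).
  by exists U; split => //; exact: ltW.
apply: le_trans (epsilon_trick _ _ (ltW e0)); last first.
  by move=> i; exact: content_outer_ge0.
apply: (@le_trans _ _ (inner_content (\bigcup_i U i))).
  apply: content_outer_le; first by apply: dopen_bigcup => i _; case: (UP i).
  by apply: subset_bigcup => i _; case: (UP i).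
apply: (le_trans (inner_content_sigma_subadditive _)) => [i|].
  by case: (UP i).
apply: lee_nneseries => [i _ _|i _]; first exact: inner_content_ge0.
by case: (UP i).
Qed.

Definition content_outer_measure : {outer_measure set X -> \bar R} :=
  HB.pack content_outer (isOuterMeasure.Build R X content_outer content_outer0
    content_outer_ge0 content_outer_mono content_outer_sigma_subadditive).

(** It suffices to split an open [V] containing [A]. A shrunken copy [K] of the intersection of [V]
    and [U] accounts for the part in [U]; the open set [O] of points of [V] away from [K] contains
    the part of [A] outside [U]. Shrunken copies of [O] are disjoint from [K], and both fit into a
    shrunken copy of [V]. *)
Lemma dopen_caratheodory U : dopen dist U ->
  content_outer_measure.-caratheodory U.
Proof.
move=> oU; apply: le_caratheodory_measurable => A.
rewrite /content_outer_measure/=.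
apply: le_content_outer => V oV AV.
rewrite -leeBrDr ?content_outer_fin_num//.
apply: (@le_trans _ _ (inner_content (V `&` U))).
  by apply: content_outer_le; [exact: dopenI|exact: setSI].
apply: inner_content_le => r r0; set K := shrink _ _ _.
rewrite leeBrDr ?content_outer_fin_num// addeC -leeBrDr//.
pose O := [set x | V x /\ exists2 e : R, (0 < e)%R &
  forall y, (dist x y < e)%R -> ~ K y].
have oO : dopen dist O.
  move=> x [Vx [e e0 xe]]; have [s s0 sV] := oV x Vx.
  exists (Num.min s (e / 2))%R; first by rewrite lt_min s0 divr_gt0.
  move=> y /=; rewrite lt_min => /andP[xs xe2]; split; first exact: sV.
  exists (e / 2)%R; first by rewrite divr_gt0.
  by move=> z yz; apply: xe; have := dist_tri metricX x y z; lra.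
apply: (@le_trans _ _ (inner_content O)).
  apply: content_outer_le => // x [Ax nUx]; split; first exact: AV.
  exists r => // y xy Ky; apply: nUx.
  by have [] : (V `&` U) x by apply: Ky; rewrite (dist_sym metricX).
apply: inner_content_le => s s0.
rewrite leeBrDr// addeC -EFinD -mU; last first.
  apply/seteqP; split => // x [Kx /(shrink_sub metricX s0)[_ [e e0 /(_ x)]]].
  by rewrite (distxx metricX) => /(_ e0).
have rs0 : (0 < Num.min r s)%R by rewrite lt_min r0.
apply: le_trans (inner_content_ge V rs0); rewrite lee_fin le_m//.
move=> x [Kx|Ox].
- by apply: shrinkS Kx; [exact: subIsetl|rewrite ge_min lexx].
- by apply: shrinkS Ox; [move=> ? []|rewrite ge_min lexx orbT].
Qed.

(** A Lebesgue number argument: a compact set inside an open [U] already lies in some shrunken copy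
    of [U]. *)
Lemma content_outer_compact Z : dcompact dist Z -> (m Z)%:E <= content_outer Z.
Proof.
move=> cZ; apply: le_content_outer => U oU ZU.
have /choice[f fP] : forall x, exists r : R, (0 < r)%R /\
    (Z x -> [set y | dist x y < r + r]%R `<=` U).
  move=> x; have [/ZU/oU[r r0 rU]|] := pselect (Z x); last by exists 1%R.
  by exists (r / 2)%R; rewrite divr_gt0//; split => // _; rewrite -splitr.
(* Centers outside [Z] contribute the empty set, so the cover can be indexed by all of [X]. *)
have oW x : dopen dist [set y | Z x /\ (dist x y < f x)%R].
  by move=> y [Zx /(dopen_ball metricX)[r r0 h]]; exists r => // z /h.
have [|F finF ZF] := cZ _ _ oW.
  by move=> z Zz; exists z => //; split=> //; rewrite (distxx metricX) (fP z).1.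
have [N [s s0 Ns]] := finite_bounds (fun=> 0%N) finF (fun x => (fP x).1).
apply: le_trans (inner_content_ge U s0); rewrite lee_fin le_m// => z Zz y zy.
have [x Fx [Zx xz]] := ZF z Zz; apply: (fP x).2 => //=.
by have := dist_tri metricX x z y; have := (Ns x Fx).2; lra.
Qed.

End outer_measure_of_content.

(** Normalization supplies the probability structure and does not alter a measure of total mass one;
    the Dirac mass is the fallback value for the excluded degenerate cases. *)
Lemma probability_of_measure (R : realType) (d : measure_display)
    (X : measurableType d) (nu : {measure set X -> \bar R}) : nu setT = 1 ->
  exists mu : probability X R, forall A, mu A = nu A.
Proof.
move=> nuT; exists (mnormalize nu (dirac point)) => A.
have E : mnormalize nu (dirac point) A = nu A * ((fine (nu setT))^-1)%:E.
  by rewrite /mnormalize; case: ifPn => //; rewrite nuT onee_eq0.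
by apply: etrans E _; rewrite nuT [fine _]/= invr1 mule1.
Qed.

(** Open sets are Caratheodory measurable, hence so are all Borel sets. The outer measure does not
    exceed [m] on open sets and is not below [m] on compact ones, which gives mass one to both [Z]
    and [X]. *)
Theorem probability_of_content (R : realType) (d : measure_display)
    (X : measurableType d) (dist : X -> X -> R) (m : set X -> R) (Z : set X) :
  is_metric dist -> borel_for dist -> dcompact dist setT -> dcompact dist Z ->
  (forall A, (0 <= m A)%R) ->
  (forall A B, A `&` B = set0 -> (m (A `|` B) = m A + m B)%R) ->
  m Z = 1%R -> m setT = 1%R ->
  exists mu : probability X R, mu Z = 1 /\
    forall U, dopen dist U -> mu U <= (m U)%:E.
Proof.
move=> metricX borelX cX cZ m_ge0 mU mZ mT.
pose M := content_outer_measure metricX cX m_ge0 mU.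
have mcara A : measurable A -> M.-caratheodory A.
  rewrite borelX => mA; apply: (@smallest_sub _ _ _ M.-caratheodory) mA.
    split.
    - exact: caratheodory_measurable_set0.
    - by move=> B mB; rewrite setTD; exact: caratheodory_measurable_setC.
    - by move=> B mB; exact: caratheodory_measurable_bigcup.
  by move=> U oU; exact: dopen_caratheodory.
have Madd : semi_sigma_additive (M : set X -> \bar R).
  move=> F mF tF mUF.
  exact: (@caratheodory_measure_sigma_additive R X M F (fun i => mcara _ (mF i)) tF
    (mcara _ mUF)).
have MT : M setT = 1.
  apply/eqP; rewrite eq_le; apply/andP; split.
    apply: le_trans (content_outer_le m (dopenT (dist := dist)) _) _ => //.
    by rewrite -mT; exact: inner_content_le_content.
  by rewrite -mT; exact: content_outer_compact.
pose nu : {measure set X -> \bar R} := HB.pack (M : set X -> \bar R)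
  (isMeasure.Build d X R (M : set X -> \bar R) (outer_measure0 M)
    (outer_measure_ge0 M) Madd).
have [mu muE] := probability_of_measure (nu := nu) MT.
exists mu; split=> [|U oU]; rewrite muE.
  apply/eqP; rewrite eq_le; apply/andP; split.
    by rewrite -MT; exact: content_outer_mono.
  by rewrite -mZ; exact: content_outer_compact.
apply: le_trans (content_outer_le m oU _) _ => //.
exact: inner_content_le_content.
Qed.

Local Close Scope ereal_scope.

(** * Greedy covers and neutralized Bowen balls *)

Section greedy.
Context {R : realType} {X I : choiceType}.
Variables (B : I -> set X) (U : X -> set X) (a : I -> R) (g : X -> R) (t : R).
Hypotheses (t0 : 0 < t) (a_ge0 : forall i, 0 <= a i) (g_ge0 : forall z, 0 <= g z).
Hypothesis BU : forall i z z', B i z -> B i z' -> U z z'.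
Hypothesis ga : forall i z, B i z -> g z <= a i.

Lemma weightE (F : seq (R * I)) z : weight B F z = \sum_(w <- F | z \in B w.2) w.1.
Proof.
rewrite /weight [RHS]big_mkcond; apply: eq_bigr => w _.
by rewrite indicE; case: ifP; rewrite ?mulr1 ?mulr0.
Qed.

(* Greedy selection: picking [z] discards every ball containing [z], and a point
   outside [U z] loses none of its weight in the process. *)
Lemma greedy_cover (F : seq (R * I)) (A : set X) : wpos F -> (forall z, A z -> t <= weight B F z) ->
  exists2 E : seq X, forall y, A y -> exists2 z, z \in E & U z y &
    t * (\sum_(z <- E) g z) <= wcost a F.
Proof.
have [n] := ubnP (size F); elim: n => // n IH in F A * => Fn Fp FA.
have [[z Az]|A0] := pselect (exists z, A z); last first.
  exists [::]; first by move=> y Ay; exfalso; apply: A0; exists y.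
  by rewrite big_nil mulr0 wcost_ge0.
pose P (w : R * I) := z \in B w.2.
pose F2 := [seq w <- F | ~~ P w].
have wF : \sum_(w <- F | P w) w.1 >= t by rewrite -weightE FA.
(* The weight at [z] is at least [t > 0], so some listed ball contains [z] and the list really gets
   shorter. *)
have F2n : (size F2 < n)%N.
  rewrite -ltnS (leq_trans _ Fn)// ltnS size_filter -(count_predC P F).
  rewrite -[X in (X < _)%N]add0n ltn_add2r -has_count.
  apply/negPn/negP => /hasPn PF; move: wF; rewrite big1_seq ?leNgt ?t0//.
  by move=> w /andP[Pw wF]; have := PF w wF; rewrite Pw.
have F2p : wpos F2.
  by rewrite /wpos all_filter; apply: sub_all Fp => w w0; apply/implyP.
have F2A y : (A `&` ~` U z) y -> t <= weight B F2 y.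
  move=> [Ay Uzy]; rewrite (le_trans (FA y Ay))// !weightE big_filter_cond.
  rewrite le_eqVlt; apply/orP; left; apply/eqP; apply: eq_bigl => w /=.
  case: (boolP (y \in B w.2)) => /=; last by rewrite andbF.
  move=> /set_mem By; rewrite andbT; apply/esym/negP => /set_mem Bz.
  by apply: Uzy; exact: BU Bz By.
have [E2 E2A E2F] := IH F2 _ F2n F2p F2A.
exists (z :: E2) => [y Ay|].
  have [Uzy|Uzy] := pselect (U z y); first by exists z; rewrite ?mem_head.
  by have [x xE Uxy] := E2A y (conj Ay Uzy); exists x; rewrite // inE xE orbT.
rewrite big_cons mulrDr.
(* The discarded balls pay for [z]: their weights add up to at least [t], and each costs at least
   [g z] per unit of weight. *)
have -> : wcost a F = \sum_(w <- F | P w) w.1 * a w.2 + wcost a F2.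
  by rewrite /wcost big_filter (bigID P).
apply: lerD => //; apply: (@le_trans _ _ ((\sum_(w <- F | P w) w.1) * g z)).
  exact: ler_wpM2r.
rewrite mulr_suml big_seq_cond [leRHS]big_seq_cond; apply: ler_sum => w /andP[wF' Pw].
rewrite ler_wpM2l ?(ga (set_mem Pw))//.
by move/allP : Fp; exact.
Qed.

End greedy.

Section nballs.
Context {R : realType} {X : Type} {dist : X -> X -> R} {T : X -> X}.
Hypotheses (metricX : is_metric dist).

Lemma bowen_sym n x y r : bowen dist T n x r y -> bowen dist T n y r x.
Proof. by move=> h j jn; rewrite (dist_sym metricX) h. Qed.

Lemma bowen_tri n x y z r s :
  bowen dist T n x r y -> bowen dist T n y s z -> bowen dist T n x (r + s) z.
Proof.
move=> h k j jn; apply: le_lt_trans (dist_tri metricX _ (iter j T y) _) _.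
by rewrite ltrD// ?h ?k.
Qed.

Lemma bowenS n x r s : r <= s -> bowen dist T n x r `<=` bowen dist T n x s.
Proof. by move=> rs y h j jn; exact: lt_le_trans (h j jn) rs. Qed.

Lemma bowen_center n x r : 0 < r -> bowen dist T n x r x.
Proof. by move=> r0 j _; rewrite (distxx metricX). Qed.

Lemma nball_center n x e : nball dist T n x e x.
Proof. by apply: bowen_center; exact: expR_gt0. Qed.

Lemma nballS n x e e' : e' <= e -> nball dist T n x e `<=` nball dist T n x e'.
Proof. by move=> ee'; apply: bowenS; rewrite ler_expR lerN2 ler_wpM2l. Qed.

Lemma nball_tri n x y z e e' :
  (expR (- (n%:R * e)) : R) + expR (- (n%:R * e)) <= expR (- (n%:R * e')) ->
  nball dist T n x e y -> nball dist T n x e z -> nball dist T n y e' z.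
Proof.
by move=> h xy xz; apply: bowenS h _ _; apply: bowen_tri (bowen_sym xy) xz.
Qed.

Hypothesis contT : dcontinuous dist T.

Lemma dcontinuous_iter j : dcontinuous dist (iter j T).
Proof.
elim: j => [|j IH] x e e0; first by exists e.
have [s s0 sP] := contT (iter j T x) e0.
have [r r0 rP] := IH x s s0.
by exists r => // y xy; rewrite !iterS; apply/sP/rP.
Qed.

Lemma bowen_dopen n x r : dopen dist (bowen dist T n x r).
Proof.
elim: n => [|n IH]; first by move=> y _; exists 1.
move=> y h; have [s s0 sP] := IH y (fun j jn => h j (ltnW jn)).
have gap : 0 < r - dist (iter n T x) (iter n T y) by rewrite subr_gt0 h.
have [u u0 uP] := dcontinuous_iter n y gap.
exists (Num.min s u); first by rewrite lt_min s0.
move=> z /=; rewrite lt_min => /andP[zs zu] j; rewrite ltnS leq_eqVlt.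
case/orP => [/eqP ->|jn]; last exact: sP.
have := dist_tri metricX (iter n T x) (iter n T y) (iter n T z).
by have := uP z zu; lra.
Qed.

Lemma nball_dopen n x e : dopen dist (nball dist T n x e).
Proof. exact: bowen_dopen. Qed.

End nballs.

Lemma expRN_small (R : realType) (c e : R) : 0 < c -> 0 < e ->
  exists N, forall n, (N <= n)%N -> expR (- (n%:R * e)) < c.
Proof.
move=> c0 e0; have ce0 : 0 <= (c * e)^-1 by rewrite invr_ge0 mulr_ge0// ltW.
(* From [n > 1 / (c e)] follows [exp (n e) >= 1 + n e > 1 / c]. *)
exists (Num.truncn (c * e)^-1).+1 => n Nn.
rewrite expRN invf_plt ?posrE ?expR_gt0//.
apply: lt_le_trans (expR_ge1Dx _).
have : (c * e)^-1 < n%:R.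
  by apply: lt_le_trans (truncnS_gt _) _; rewrite ler_nat.
by rewrite -(ltr_pM2r e0) invfM mulfVK ?gt_eqF//; lra.
Qed.

(** A geometric series of ratio [q = exp (- e)]: the partial sums are at most
    [exp (- n e) / (1 - q)], and [N] makes the numerator smaller than [1 - q]. *)
Lemma expRN_sum_lt1 (R : realType) (e : R) : 0 < e -> exists N, forall n K,
  (N <= n)%N -> \sum_(k < K) expR (- ((n + k)%:R * e)) < 1.
Proof.
move=> e0; pose q := expR (- e).
have q1 : 0 < 1 - q by rewrite subr_gt0 expR_lt1 oppr_lt0.
have [N NP] := expRN_small q1 e0; exists N => n K Nn.
have E k : expR (- ((n + k)%:R * e)) = expR (- (n%:R * e)) * q ^+ k :> R.
  by rewrite -expRM_natl -expRD natrD; congr expR; ring.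
have -> : \sum_(k < K) expR (- ((n + k)%:R * e)) =
    expR (- (n%:R * e)) * \sum_(k < K) q ^+ k.
  by rewrite mulr_sumr; apply: eq_bigr => k _.
have := subrX1 q K; set S := \sum_(k < K) _ => qS.
have qK : 0 <= q ^+ K by rewrite exprn_ge0// expR_ge0.
have := NP n Nn; set u := expR _ => uq.
have S1 : (1 - q) * S <= 1 by lra.
have u0 : 0 < u by exact: expR_gt0.
rewrite -(ltr_pM2l q1) mulr1 mulrCA.
apply: le_lt_trans uq; rewrite -[leRHS]mulr1; apply: ler_wpM2l => //; exact: ltW.
Qed.

(** With [u = exp (- n e / 2)] the claim reads [2 u^2 <= u], true once [u <= 1 / 2]. Thus halving
    the scale absorbs the doubling of the radius in the triangle inequality. *)
Lemma expRN_double (R : realType) (e : R) : 0 < e -> exists N, forall n, (N <= n)%N ->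
  expR (- (n%:R * e)) + expR (- (n%:R * e)) <= expR (- (n%:R * (e / 2))) :> R.
Proof.
move=> e0; have e20 : 0 < e / 2 by rewrite divr_gt0.
have h0 : 0 < 2^-1 :> R by rewrite invr_gt0.
have [N NP] := expRN_small h0 e20; exists N => n Nn.
have -> : n%:R * e = n%:R * (e / 2) + n%:R * (e / 2) by field.
rewrite opprD expRD; have := NP n Nn; have := expR_gt0 (- (n%:R * (e / 2))).
set u := expR _; nra.
Qed.

(** * A Frostman measure for neutralized balls *)

Local Open Scope ereal_scope.

Lemma at_right0P (R : realType) (P : R -> Prop) :
  (\forall e \near 0%R^'+, P e) <->
  exists2 e0 : R, (0 < e0)%R & forall e, (0 < e)%R -> (e < e0)%R -> P e.
Proof.
split.
  move=> [e0 /= e0p h]; exists e0 => // e ep ee0.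
  by apply: h => //=; rewrite sub0r normrN gtr0_norm.
move=> [e0 e0p h]; exists e0 => //= e /=.
by rewrite sub0r normrN => + ep; rewrite gtr0_norm//; exact: h.
Qed.

Lemma limn_esup_ltP (R : realType) (u : nat -> \bar R) (c : \bar R) :
  limn_esup u < c -> exists N, forall n, (N <= n)%N -> u n < c.
Proof.
rewrite limn_esup_lim (cvg_lim _ (@cvg_esups_inf _ u))//.
move=> /ereal_inf_lt[_ [N _ <-] uN]; exists N => n Nn.
by apply: le_lt_trans uN; apply: ereal_sup_ubound; exists n.
Qed.

Lemma limn_einf_ge (R : realType) (u : nat -> \bar R) (c : \bar R) N :
  (forall n, (N <= n)%N -> c <= u n) -> c <= limn_einf u.
Proof.
move=> cu; rewrite limn_einf_lim (cvg_lim _ (@cvg_einfs_sup _ u))//.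
apply: (@le_trans _ _ (einfs u N)); last by apply: ereal_sup_ubound; exists N.
by apply: le_ereal_inf_tmp => _ [n Nn <-]; exact: cu.
Qed.

Lemma limn_einf_gtP (R : realType) (u : nat -> \bar R) (c : \bar R) :
  c < limn_einf u -> exists N, forall n, (N <= n)%N -> c < u n.
Proof.
rewrite limn_einf_lim (cvg_lim _ (@cvg_einfs_sup _ u))//.
move=> /ereal_sup_gt[_ [N _ <-] uN]; exists N => n Nn.
by apply: lt_le_trans uN _; apply: ereal_inf_lbound; exists n.
Qed.

(** A nondecreasing sequence tends to its supremum. The vanishing of [Ms] or [Ls] thus becomes a
    condition at each [N], refuted by a single [N] of positive cost. *)
Lemma limn_nondecreasing_eq0 (R : realType) (u : nat -> \bar R) :
  (forall n, 0 <= u n) -> nondecreasing_seq u ->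
  limn u = 0 <-> forall n, u n = 0.
Proof.
move=> u0 undec; have := ereal_nondecreasing_cvgn undec.
move=> /(@cvg_lim _ (@ereal_hausdorff R)) ->; split=> [supu n|un0].
  by apply/eqP; rewrite eq_le u0 -supu andbT; apply: ereal_sup_ubound; exists n.
apply/eqP; rewrite eq_le; apply/andP; split.
  by apply: ge_ereal_sup => _ [n _ <-]; rewrite un0.
by rewrite -(un0 0%N); apply: ereal_sup_ubound; exists 0%N.
Qed.

Definition distortion_le {R : realType} {X : Type} (dist : X -> X -> R) (T : X -> X)
    (Phi : nat -> X -> R) (e del : R) (N : nat) := forall n x y, (N <= n)%N ->
  nball dist T n x e y -> (`|Phi n x - Phi n y| <= n%:R * del)%R.

Section tempered.
Context {R : realType} {X : Type} {dist : X -> X -> R} {T : X -> X}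
  {Phi : nat -> X -> R}.

Lemma tempered_distortion_le : tempered_distortion dist T Phi ->
  forall del : R, (0 < del)%R -> exists2 e0 : R, (0 < e0)%R &
    forall e, (0 < e)%R -> (e < e0)%R -> exists N, distortion_le dist T Phi e del N.
Proof.
move=> temp del del0.
have /temp : ereal_nbhs (0 : \bar R) (fun u => u < del%:E).
  by apply: open_ereal_lt'; rewrite lte_fin.
move=> /at_right0P[e0 e00 h]; exists e0 => // e e_gt0 ee0.
have [N NP] := limn_esup_ltP (h e e_gt0 ee0).
(* The successor excludes [n = 0], where the inverse of [n] takes its default value. *)
exists N.+1 => n x y Nn xy; have n0 : (0 < n%:R :> R)%R by rewrite ltr0n; lia.
have := NP n (ltnW Nn); rewrite mulrC => Dn.
rewrite -ler_pdivrMr// -lee_fin EFinM; apply: le_trans (ltW Dn).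
apply: lee_wpmul2r; first by rewrite lee_fin invr_ge0 ltW.
by apply: ereal_sup_ubound; exists x, y.
Qed.

End tempered.

(** The real counterpart of [cterm]: on a compact space the supremum of a continuous function over a
    ball is finite, so [fine] loses nothing ([ctermE]). *)
Definition rcterm {R : realType} {X : Type} (dist : X -> X -> R) (T : X -> X)
    (Phi : nat -> X -> R) (s : R) (n : nat) (x : X) (e : R) : R :=
  expR (- (n%:R * s) + fine (supphi dist T Phi n x e)).

(** * Covering costs and the Frostman measure *)

Section pressure.
Context {R : realType} {d : measure_display} {X : measurableType d}
  {dist : X -> X -> R} {T : X -> X} {Phi : nat -> X -> R}.
Hypotheses (metricX : is_metric dist) (cX : dcompact dist setT)
  (contT : dcontinuous dist T) (contPhi : forall n, dcontinuous_real dist (Phi n)).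

Lemma Phi_bounded n : exists M : R, forall x, (Phi n x <= M)%R.
Proof.
have oU (k : nat) : dopen dist [set x | (Phi n x < k%:R)%R].
  move=> x /= xk; have gap : (0 < k%:R - Phi n x)%R by rewrite subr_gt0.
  have [r r0 rP] := @contPhi n x _ gap; exists r => // y /rP.
  by rewrite distrC => /ltr_normlW/=; lra.
have [|F finF XF] := cX oU.
  move=> x _; exists (Num.truncn `|Phi n x|%R).+1 => //=.
  by rewrite (le_lt_trans (ler_norm _))// truncnS_gt.
have [N [r r0 NP]] := finite_bounds (R := R) id finF (fun=> ltr01).
exists N%:R => x; have [k Fk /= xk] := XF x I.
by rewrite (le_trans (ltW xk))// ler_nat ltnW//; case: (NP k Fk).
Qed.

Lemma supphi_ge n x e y : nball dist T n x e y ->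
  (Phi n y)%:E <= supphi dist T Phi n x e.
Proof. by move=> xy; apply: ereal_sup_ubound; exists y. Qed.

Lemma supphi_le n x e c : (forall y, nball dist T n x e y -> (Phi n y)%:E <= c) ->
  supphi dist T Phi n x e <= c.
Proof. by move=> h; apply: ge_ereal_sup => _ [y xy <-]; exact: h. Qed.

Lemma supphi_fin_num n x e : supphi dist T Phi n x e \is a fin_num.
Proof.
have [M PM] := Phi_bounded n.
have cx : nball dist T n x e x by exact: nball_center.
rewrite fin_numElt; apply/andP; split.
  by apply: lt_le_trans (supphi_ge cx); rewrite ltNyr.
apply: le_lt_trans (ltry M); apply: supphi_le => y _.
by rewrite lee_fin.
Qed.

Lemma ctermE s n x e : cterm dist T Phi s n x e = (rcterm dist T Phi s n x e)%:E.
Proof. by rewrite /cterm -(fineK (supphi_fin_num n x e)). Qed.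

Lemma cterm_ge0 s n x e : 0 <= cterm dist T Phi s n x e.
Proof. exact: expeR_ge0. Qed.

Lemma rcterm_ge0 s n x e : (0 <= rcterm dist T Phi s n x e)%R.
Proof. exact: expR_ge0. Qed.

Lemma rcterm_ge s n x e y : nball dist T n x e y ->
  (expR (- (n%:R * s) + Phi n y) <= rcterm dist T Phi s n x e)%R.
Proof.
move=> xy; rewrite ler_expR lerD2l -lee_fin fineK ?supphi_fin_num//.
exact: supphi_ge.
Qed.

Lemma rcterm_le s n x e c : (forall y, nball dist T n x e y -> (Phi n y <= c)%R) ->
  (rcterm dist T Phi s n x e <= expR (- (n%:R * s) + c))%R.
Proof.
move=> h; rewrite ler_expR lerD2l -lee_fin fineK ?supphi_fin_num//.
by apply: supphi_le => y /h; rewrite lee_fin.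
Qed.

Lemma rcterm_anti s s' n x e : (s' <= s)%R ->
  (rcterm dist T Phi s n x e <= rcterm dist T Phi s' n x e)%R.
Proof. by move=> ss; rewrite ler_expR lerD2r lerN2 ler_wpM2l. Qed.

Lemma MNs_ge0 Z N e s : 0 <= MNs dist T Phi Z N e s.
Proof.
apply: le_ereal_inf_tmp => _ [I [n [x [_ _ ->]]]].
by apply: esum_ge0 => i _; exact: cterm_ge0.
Qed.

Lemma MNs_nondecreasing Z e s : nondecreasing_seq (fun N => MNs dist T Phi Z N e s).
Proof.
move=> N N' NN'; apply: ereal_inf_le_tmp => _ [I [n [x [nN ZI ->]]]].
by exists I, n, x; split=> // i /nN; exact: leq_trans.
Qed.

Lemma Ms_eq0 Z e s :
  Ms dist T Phi Z e s = 0 <-> forall N, MNs dist T Phi Z N e s = 0.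
Proof.
apply: limn_nondecreasing_eq0; first by move=> N; exact: MNs_ge0.
exact: MNs_nondecreasing.
Qed.

Lemma MNs_le_seq (Z : set X) N e s (P : seq (nat * X)) :
  (forall p, p \in P -> (N <= p.1)%N) ->
  (forall z, Z z -> exists2 p, p \in P & nball dist T p.1 p.2 e z) ->
  MNs dist T Phi Z N e s <= (\sum_(p <- P) rcterm dist T Phi s p.1 p.2 e)%R%:E.
Proof.
move=> PN PZ; pose p0 : nat * X := (0%N, point).
apply: ereal_inf_lbound; exists `I_(size P), (fun i => (nth p0 P i).1),
  (fun i => (nth p0 P i).2); split.
- by move=> i iP; apply: PN; exact: mem_nth.
- move=> z /PZ[p pP pz]; exists (index p P); first by rewrite /= index_mem.
  by rewrite /= nth_index.
- rewrite esum_fset//; last by move=> i _; exact: cterm_ge0.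
  rewrite -fsbig_ord (big_nth p0) big_mkord -sumEFin.
  by apply: eq_bigr => i _; rewrite ctermE.
Qed.

Lemma sum_levels (F : seq (R * (nat * X))) K (h : R * (nat * X) -> R) :
  (forall w, w \in F -> (w.2.1 < K)%N) ->
  (\sum_(w <- F) h w = \sum_(k < K) \sum_(w <- F | w.2.1 == k) h w)%R.
Proof.
move=> FK; rewrite (exchange_big_dep xpredT)//= big_seq [RHS]big_seq.
apply: eq_bigr => w wF; rewrite (big_pred1 (Ordinal (FK w wF)))//.
Qed.

(* A weighted cover by balls of scale [e] is turned into a genuine one by balls of
   scale [e / 2], one level [n] at a time: a point is charged to a level on which
   its weight is at least [exp (- n del)], which exists since those thresholds sum to
   less than 1. The distortion bound and the thresholds cost [del] each in [s].
   An index [(k, x)] stands for the ball of length [N + k] around [x], so that the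
   indices range exactly over the balls of length at least [N]. *)
Lemma MNs_le_wcost (Z : set X) (N : nat) (e s del : R) (F : seq (R * (nat * X))) :
  (forall n, (N <= n)%N -> expR (- (n%:R * e)) + expR (- (n%:R * e)) <=
     expR (- (n%:R * (e / 2))) :> R)%R ->
  (forall K, \sum_(k < K) expR (- ((N + k)%:R * del)) < 1 :> R)%R ->
  distortion_le dist T Phi (e / 2) del N ->
  wpos F ->
  (forall z, Z z -> (1 <= weight (fun i => nball dist T (N + i.1) i.2 e) F z)%R) ->
  MNs dist T Phi Z N (e / 2) (s + 2 * del) <=
    (wcost (fun i => rcterm dist T Phi s (N + i.1) i.2 e) F)%:E.
Proof.
move=> e2 tsum dis Fp FZ.
have [K FK] : exists K, forall w, w \in F -> (w.2.1 < K)%N.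
  exists (\max_(w <- F) w.2.1).+1 => w wF; rewrite ltnS.
  exact: (@leq_bigmax_seq _ F xpredT (fun w => w.2.1) w wF isT).
pose t k : R := expR (- ((N + k)%:R * del)).
pose G k : seq (R * X) := [seq (w.1, w.2.2) | w <- F & w.2.1 == k].
pose Bk k (x : X) := nball dist T (N + k) x e.
(* A lower bound for the cost of every ball of level [k] that contains [z], as the greedy selection
   requires. *)
pose g k z : R := expR (- ((N + k)%:R * s) + Phi (N + k) z).
pose Zk k := [set z : X | (t k <= weight (Bk k) (G k) z)%R].
have weightG k z : (weight (Bk k) (G k) z =
    \sum_(w <- F | w.2.1 == k) w.1 * \1_(nball dist T (N + w.2.1) w.2.2 e) z)%R.
  by rewrite /weight big_map big_filter; apply: eq_bigr => w /eqP ->.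
have wcostG k : (wcost (fun x => rcterm dist T Phi s (N + k) x e) (G k) =
    \sum_(w <- F | w.2.1 == k) w.1 * rcterm dist T Phi s (N + w.2.1) w.2.2 e)%R.
  by rewrite /wcost big_map big_filter; apply: eq_bigr => w /eqP ->.
have /choice[E EP] : forall k, exists E : seq X,
    (forall y, Zk k y -> exists2 z, z \in E & nball dist T (N + k) z (e / 2) y) /\
    (t k * (\sum_(z <- E) g k z) <= wcost (fun x => rcterm dist T Phi s (N + k) x e) (G k))%R.
  move=> k; have [|||||||E EZ Ecost] := @greedy_cover R X X (Bk k)
      (fun z => nball dist T (N + k) z (e / 2)) (fun x => rcterm dist T Phi s (N + k) x e)
      (g k) (t k) _ _ _ _ _ (G k) (Zk k).
  - exact: expR_gt0.
  - by move=> i; exact: rcterm_ge0.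
  - by move=> z; exact: expR_ge0.
  - by move=> i z z'; apply: nball_tri => //; apply: e2; exact: leq_addr.
  - by move=> i z; exact: rcterm_ge.
  - rewrite /wpos all_map all_filter; apply: sub_all Fp => w w0.
    by apply/implyP.
  - by [].
  - by exists E.
pose P := [seq ((N + k)%N, z) | k <- index_iota 0 K, z <- E k].
apply: (@le_trans _ _ (\sum_(p <- P) rcterm dist T Phi (s + 2 * del) p.1 p.2 (e / 2))%R%:E).
  apply: MNs_le_seq => [p /allpairsPdep[k [z [_ _ ->]]]|z Zz].
    exact: leq_addr.
  have [[k kK tk]|nk] := pselect (exists2 k, (k < K)%N & Zk k z).
    have [x xE xz] := (EP k).1 z tk; exists ((N + k)%N, x) => //.
    by apply/allpairsPdep; exists k, x; rewrite mem_index_iota.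
  exfalso; have := FZ z Zz; rewrite /weight (sum_levels _ FK); apply/negP.
  rewrite -ltNge; apply: le_lt_trans (tsum K); apply: ler_sum => k _.
  rewrite -weightG; apply: ltW; rewrite ltNge; apply/negP => tk.
  by apply: nk; exists k.
rewrite lee_fin big_allpairs_dep /= /wcost (sum_levels _ FK) big_mkord.
apply: ler_sum => k _; rewrite -wcostG; apply: le_trans (EP k).2.
rewrite mulr_sumr; apply: ler_sum => z _.
apply: le_trans (rcterm_le (c := (Phi (N + k) z + (N + k)%:R * del)%R) _ _) _.
  move=> y /(dis _ _ _ (leq_addr _ _)).
  by rewrite distrC => /ler_normlW; lra.
by rewrite /t /g -expRD le_eqVlt; apply/orP; left; apply/eqP; congr expR; ring.
Qed.

(** The reference cover for [wfunctional]: finitely many open balls of length [N], encoded by index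
    0, cover the compact space, each taken with weight one. *)
Lemma exists_finite_weighted_cover (Z : set X) N e : exists F : seq (R * (nat * X)),
  wpos F /\ forall z, Z z -> (1 <= weight (fun i => nball dist T (N + i.1) i.2 e) F z)%R.
Proof.
have oB x : dopen dist (nball dist T N x e) by exact: nball_dopen.
have [|A /finite_seqP[l lA] TA] := cX oB.
  by move=> x _; exists x => //; exact: nball_center.
exists [seq (1%R, (0%N, x)) | x <- l]; split.
  by rewrite /wpos all_map; apply/allP => x _ /=; exact: ler01.
move=> z _; have [x] := TA z I; rewrite lA /= => xl xz.
rewrite /weight big_map (big_rem x)//= addn0 mul1r indicE mem_set// lerDl.
by apply: sumr_ge0 => y _; rewrite mul1r indicE ler0n.
Qed.

Hypothesis borelX : borel_for dist.

(** Duality gives a content with the required ball bounds. They survive the passage to a Borel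
    probability because neutralized balls are open. *)
Theorem neutralized_frostman (Z : set X) (N : nat) (e s k : R) : dcompact dist Z ->
  (0 < k)%R ->
  (forall F, wpos F ->
    (forall z, Z z -> (1 <= weight (fun i => nball dist T (N + i.1) i.2 e) F z)%R) ->
    (k <= wcost (fun i => rcterm dist T Phi s (N + i.1) i.2 e) F)%R) ->
  exists2 mu : probability X R, mu Z = 1 & forall n x, (N <= n)%N ->
    mu (nball dist T n x e) <= (k^-1 * rcterm dist T Phi s n x e)%:E.
Proof.
move=> cZ k0 kF; have [F [Fp FZ]] := exists_finite_weighted_cover Z N e.
have [m [m0 mU mZ mT mB]] := weighted_cover_duality
  (fun i => rcterm_ge0 s (N + i.1) i.2 e) Fp FZ k0 kF.
have [mu [muZ mule]] := probability_of_content metricX borelX cX cZ m0 mU mZ mT.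
exists mu => // n x Nn; apply: le_trans (mule _ _) _; first exact: nball_dopen.
by rewrite lee_fin; have := mB ((n - N)%N, x); rewrite /= subnKC.
Qed.

Lemma frostman_below_Mcrit (Z : set X) (e s del : R) (N0 : nat) : dcompact dist Z ->
  (0 < e)%R -> (0 < del)%R -> distortion_le dist T Phi (e / 2) del N0 ->
  (s + 2 * del)%:E < Mcrit dist T Phi Z (e / 2) ->
  exists mu : probability X R, exists N, exists c : R,
    [/\ mu Z = 1, (0 < c)%R & forall n x, (N <= n)%N ->
      mu (nball dist T n x e) <= (c * rcterm dist T Phi s n x e)%:E].
Proof.
move=> cZ e0 del0 dis sM.
have [N1 MN1] : exists N, 0 < MNs dist T Phi Z N (e / 2) (s + 2 * del).
  apply: contrapT => nM; move: sM; apply/negP; rewrite -leNgt.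
  apply: ereal_inf_lbound; exists (s + 2 * del)%R => //=; apply/Ms_eq0 => N.
  apply/eqP; rewrite eq_le MNs_ge0 andbT leNgt; apply/negP => MN.
  by apply: nM; exists N.
have [N2 N2P] := expRN_sum_lt1 del0.
have [N3 N3P] := expRN_double e0.
(* One length beyond all four thresholds; the covering cost stays positive because it is
   nondecreasing in the minimal length. *)
pose N := (N0 + N1 + N2 + N3)%N.
have MN : 0 < MNs dist T Phi Z N (e / 2) (s + 2 * del).
  by apply: lt_le_trans MN1 _; apply: MNs_nondecreasing; lia.
(* The cost may be infinite, in which case 1 serves as the lower bound. *)
have [k k0 kM] : exists2 k : R, (0 < k)%R &
    k%:E <= MNs dist T Phi Z N (e / 2) (s + 2 * del).
  case: (MNs _ _ _ _ _ _ _) MN => [k||//] k0; first by exists k.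
  by exists 1%R => //; rewrite leey.
have [|mu muZ muB] := @neutralized_frostman Z N e s k cZ k0.
  move=> F Fp FZ; rewrite -lee_fin; apply: le_trans kM _.
  apply: MNs_le_wcost => //.
  - by move=> n Nn; apply: N3P; lia.
  - by move=> K; apply: N2P; lia.
  - by move=> n x y Nn; apply: dis; lia.
by exists mu, N, k^-1%R; split=> //; rewrite invr_gt0.
Qed.

End pressure.

(** * Measurability of the local pressure *)

Section real_sequences.
Context {R : realType}.

Lemma lne_gtP (m : \bar R) y : 0 <= m -> (y < lne m) = (expeR y < m).
Proof.
by move=> m0; rewrite -[in RHS](lneK (x := m)) ?lte_expeR// in_itv/= m0 leey.
Qed.

Lemma lne_leP (m : \bar R) y : 0 <= m -> (lne m <= y) = (m <= expeR y).
Proof. by move=> m0; rewrite leNgt lne_gtP// -leNgt. Qed.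

(** This and [local_rate_ge] translate between rates and measures of balls. Infinite logarithms are
    treated separately, in particular that of a null ball. *)
Lemma local_rate_gt (m : \bar R) (s phi : R) n : (0 < n)%N -> 0 <= m ->
  s%:E < (- lne m + phi%:E) * (n%:R^-1)%:E -> m <= (expR (- (n%:R * s) + phi))%:E.
Proof.
move=> n0 m0; have nR : (0 < n%:R^-1 :> R)%R by rewrite invr_gt0 ltr0n.
rewrite -[leRHS]/(expeR (- (n%:R * s) + phi)%:E) -lne_leP//.
case: (lne m) => [l| |]; rewrite ?leNye//.
  rewrite -EFinN -EFinD -EFinM lte_fin lee_fin ltr_pdivlMr ?ltr0n//.
  by rewrite mulrC; lra.
by rewrite [- +oo]/= addNye gt0_mulNye ?lte_fin// ltNge leNye.
Qed.

Lemma local_rate_ge (m : \bar R) (s phi : R) n : (0 < n)%N -> 0 <= m ->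
  m <= (expR (- (n%:R * s) + phi))%:E -> s%:E <= (- lne m + phi%:E) * (n%:R^-1)%:E.
Proof.
move=> n0 m0; have nR : (0 < n%:R^-1 :> R)%R by rewrite invr_gt0 ltr0n.
rewrite -[(expR _)%:E]/(expeR (- (n%:R * s) + phi)%:E) -lne_leP//.
case: (lne m) => [l| |] //.
  rewrite -EFinN -EFinD -EFinM !lee_fin ler_pdivlMr ?ltr0n//.
  by rewrite mulrC; lra.
by move=> _; rewrite [- -oo]/= addye// gt0_mulye ?lte_fin// leey.
Qed.

End real_sequences.

Section measure_lemmas.
Context {R : realType} {d : measure_display} {X : measurableType d}.

Lemma measurable_fun_gt (f : X -> \bar R) :
  (forall y : R, measurable [set x | y%:E < f x]) -> measurable_fun setT f.
Proof.
move=> mf _; apply: (measurability _ (ErealGenOInfty.measurableE R)) => //.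
move=> _ [_ [y ->] <-]; rewrite setTI.
rewrite (_ : _ @^-1` _ = [set x | y%:E < f x])//.
by apply/seteqP; split => x /=; rewrite in_itv/= andbT.
Qed.

Variable mu : probability X R.

(** Integrability is not assumed: positive and negative parts are compared separately, and
    subtraction with the convention [+oo - +oo = -oo] respects the order. *)
Lemma le_integralW (f g : X -> \bar R) :
  measurable_fun setT f -> measurable_fun setT g -> (forall x, f x <= g x) ->
  \int[mu]_x f x <= \int[mu]_x g x.
Proof.
move=> mf mg fg; rewrite integralE [leRHS]integralE leeB//.
- apply: ge0_le_integral => //; [exact: measurable_funepos..|].
  by move=> x _; apply: (@funepos_le _ _ setT) => //; rewrite inE.
- apply: ge0_le_integral => //; [exact: measurable_funeneg..|].
  by move=> x _; apply: (@funeneg_le _ _ setT) => //; rewrite inE.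
Qed.

Lemma integral_probability_cst (c : \bar R) : \int[mu]_x (cst c) x = c.
Proof.
rewrite integral_cst//; apply: etrans (mule1 c); congr (c * _).
exact: probability_setT.
Qed.

Lemma integral_ge_cst (f : X -> \bar R) c :
  measurable_fun setT f -> (forall x, c <= f x) -> c <= \int[mu]_x f x.
Proof.
move=> mf cf; rewrite -[leLHS]integral_probability_cst.
exact: le_integralW.
Qed.

(** If [f <= c] almost everywhere, then [f] agrees almost everywhere with [mine (f x) c], whose
    integral is at most [c]. *)
Lemma integral_gt_measure (f : X -> \bar R) c :
  measurable_fun setT f -> c < \int[mu]_x f x -> 0 < mu [set x | c < f x].
Proof.
move=> mf cint; rewrite lt_neqAle measure_ge0 andbT eq_sym; apply/eqP => f0.
pose g x := mine (f x) c.
have mg : measurable_fun setT g by apply: measurable_mine.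
have fg : ae_eq mu setT f g.
  exists [set x | c < f x]; split=> //.
    rewrite -[X in measurable X]setTI; exact: emeasurable_fun_o_infty.
  move=> x /= nfg; rewrite ltNge; apply/negP => fc; apply: nfg => _.
  by rewrite /g min_l.
move: cint; rewrite (ae_eq_integral g)//; apply/negP; rewrite -leNgt.
rewrite -[leRHS]integral_probability_cst; apply: le_integralW => //= x.
by rewrite /g ge_min lexx orbT.
Qed.

Lemma measure_le_esum (A : set X) (I : set nat) (b : nat -> set X)
    (v : nat -> \bar R) (c : R) :
  measurable A -> (forall i, I i -> measurable (b i)) ->
  A `<=` \bigcup_(i in I) b i -> (forall i, I i -> 0 <= v i) -> (0 <= c)%R ->
  (forall i, I i -> mu (b i) <= c%:E * v i) ->
  mu A <= c%:E * \esum_(i in I) v i.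
Proof.
move=> mA mb Ab v0 c0 bv; rewrite esum_mkcond -nneseries_esumT; last first.
  by move=> i; case: ifPn => // /set_mem; exact: v0.
rewrite -nneseriesZl; last by move=> i _; case: ifPn => // /set_mem; exact: v0.
apply: (@le_trans _ _ (\sum_(i <oo) mu (if i \in I then b i else set0))).
  apply: measure_sigma_subadditive => //.
    by move=> i; case: ifPn => // /set_mem; exact: mb.
  by move=> x /Ab[i Ii bx]; exists i => //; rewrite mem_set.
apply: lee_nneseries => [i _ _|i _]; first exact: measure_ge0.
by case: ifPn => [/set_mem/bv//|_]; rewrite measure0 mule0.
Qed.

End measure_lemmas.

Section borel.
Context {R : realType} {d : measure_display} {X : measurableType d}
  {dist : X -> X -> R} {T : X -> X}.
Hypotheses (metricX : is_metric dist) (borelX : borel_for dist)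
  (contT : dcontinuous dist T).

Lemma dopen_measurable U : dopen dist U -> measurable U.
Proof. by move=> oU; rewrite borelX; exact: sub_gen_smallest. Qed.

(** Compact sets are closed: for [x] outside [Z], the complements of the closed balls of radius
    [1 / (k + 1)] around [x] cover [Z], and a finite subcover leaves a ball around [x] free of
    [Z]. *)
Lemma dcompact_measurable Z : dcompact dist Z -> measurable Z.
Proof.
move=> cZ; rewrite -(setCK Z); apply: measurableC; apply: dopen_measurable.
move=> x nZx; pose a (k : nat) : R := (k.+1%:R^-1)%R.
have a0 k : (0 < a k)%R by rewrite invr_gt0 ltr0n.
have oU k : dopen dist [set y | (a k < dist x y)%R].
  move=> y /= xy; exists (dist x y - a k)%R; first by rewrite subr_gt0.
  move=> z /= yz; have := dist_tri metricX x z y.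
  by rewrite (dist_sym metricX z y); lra.
have [|F finF ZF] := cZ _ _ oU.
  move=> y Zy; have xy : (0 < dist x y)%R.
    rewrite lt_def (dist_ge0 metricX) andbT; apply/eqP => xy0.
    have [_ [sep _]] := metricX.
    by apply: nZx; rewrite (_ : x = y)//; apply/sep.
  exists (Num.truncn (dist x y)^-1) => //=.
  rewrite /a invf_plt ?posrE ?ltr0n// -[ltLHS]invrK.
  by rewrite invrK truncnS_gt.
have [N [s s0 sF]] := finite_bounds id finF a0.
exists s => // y /= xs Zy; have [k Fk /= ky] := ZF y Zy.
by have := (sF k Fk).2; lra.
Qed.

Lemma dcontinuous_measurable f : dcontinuous_real dist f -> measurable_fun setT f.
Proof.
move=> cf; apply/measurable_EFinP/measurable_fun_gt => y.
apply: dopen_measurable => x /=; rewrite lte_fin => yx.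
have gap : (0 < f x - y)%R by rewrite subr_gt0.
have [r r0 rP] := cf x _ gap; exists r => // z /rP /=.
by rewrite lte_fin => /ltr_normlW; lra.
Qed.

(** Finitely many strict inequalities leave common slack, so a Bowen ball is the union of the
    concentric ones of smaller radius. *)
Lemma bowen_margin n x y (r : R) : (0 < r)%R -> bowen dist T n x r y ->
  exists2 s : R, (0 < s)%R & bowen dist T n x (r - s)%R y.
Proof.
move=> r0; elim: n => [_|n IH xy]; first by exists r.
have [s s0 sP] := IH (fun j jn => xy j (ltnW jn)).
have gap : (0 < (r - dist (iter n T x) (iter n T y)) / 2)%R.
  by rewrite divr_gt0// subr_gt0 xy.
set g := (_ / 2)%R in gap; exists (Num.min s g); first by rewrite lt_min s0.
have ms : (Num.min s g <= s)%R by rewrite ge_min lexx.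
have mg : (Num.min s g <= g)%R by rewrite ge_min lexx orbT.
move=> j; rewrite ltnS leq_eqVlt => /orP[/eqP ->|jn].
  by have := xy n (ltnSn n); move: mg; rewrite /g; lra.
by have := sP j jn; lra.
Qed.

(** By continuity from below, some ball of radius [r - a k] around [x] already has measure above
    [c]. It is contained in the ball of radius [r] around any [y] that is [a k]-close to [x] along
    the orbit. *)
Lemma measure_bowen_lsc (mu : probability X R) n (r : R) c : (0 < r)%R ->
  dopen dist [set x | c < mu (bowen dist T n x r)].
Proof.
move=> r0 x /= cx; pose a (k : nat) : R := (k.+1%:R^-1)%R.
have a0 k : (0 < a k)%R by rewrite invr_gt0 ltr0n.
pose F k := bowen dist T n x (r - a k)%R.
have mF k : measurable (F k) by apply: dopen_measurable; exact: bowen_dopen.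
have FU : \bigcup_k F k = bowen dist T n x r.
  apply/seteqP; split=> y.
    by move=> [k _]; apply: bowenS; have := a0 k; lra.
  move=> /(bowen_margin r0)[s s0 sy]; exists (Num.truncn s^-1) => //.
  apply: bowenS sy; rewrite lerD2l lerN2 ltW// /a invf_plt ?posrE ?ltr0n//.
  exact: truncnS_gt.
have ndF : nondecreasing_seq F.
  move=> k l kl; apply/subsetPset/bowenS; rewrite lerD2l lerN2 /a.
  by rewrite lef_pV2 ?posrE ?ltr0n// ler_nat.
have mFU : measurable (\bigcup_k F k) by exact: bigcup_measurable.
have [k ck] : exists k, c < mu (F k).
  apply: contrapT => nk; move: cx; rewrite -FU; apply/negP; rewrite -leNgt.
  have cvgF := nondecreasing_cvg_mu (mu := mu) mF mFU ndF.
  rewrite -(cvg_lim _ cvgF)//; apply: lime_le; first by apply/cvg_ex; eexists; exact: cvgF.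
  apply: nearW => k; rewrite leNgt; apply/negP => ck; apply: nk.
  by exists k.
have cxa : bowen dist T n x (a k) x by exact: bowen_center.
have [s s0 sP] := bowen_dopen metricX contT cxa.
exists s => // y /sP /(bowen_sym metricX) yx; apply: lt_le_trans ck _.
apply: le_measure; rewrite ?inE//.
  by apply: dopen_measurable; exact: bowen_dopen.
move=> z xz; have := bowen_tri metricX yx xz.
by rewrite addrC subrK.
Qed.

Lemma measurable_measure_nball (mu : probability X R) n e :
  measurable_fun setT (fun x => lne (mu (nball dist T n x e))).
Proof.
apply: measurable_fun_gt => y; apply: dopen_measurable.
rewrite (_ : [set _ | _] = [set x | expeR y%:E < mu (nball dist T n x e)]).
  by apply: measure_bowen_lsc; exact: expR_gt0.
by apply/funext => x /=; rewrite lne_gtP.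
Qed.

Variable Phi : nat -> X -> R.
Hypothesis contPhi : forall n, dcontinuous_real dist (Phi n).

Lemma measurable_local_rate (mu : probability X R) n e :
  measurable_fun setT (fun x =>
    (- lne (mu (nball dist T n x e)) + (Phi n x)%:E) * (n%:R^-1)%:E).
Proof.
under eq_fun do rewrite muleC.
apply: measurable_funeM; apply: emeasurable_funD.
  by apply: measurableT_comp => //; exact: measurable_measure_nball.
exact/measurable_EFinP/dcontinuous_measurable.
Qed.

Lemma measurable_lowerBK_at (mu : probability X R) e :
  measurable_fun setT (lowerBK_at dist T Phi mu e).
Proof.
rewrite /lowerBK_at /limn_einf; apply: measurableT_comp => //.
apply: measurable_fun_limn_esup => n; apply: measurableT_comp => //.
exact: measurable_local_rate.
Qed.

End borel.

(** * The variational principle *)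

(** Testing against real levels treats finite and infinite limits alike: at an infinite [L] one of
    the two conditions is vacuous. *)
Lemma cvge_at_right0 (R : realType) (f : R -> \bar R) (L : \bar R) :
  (forall a : R, a%:E < L -> \forall e \near 0%R^'+, a%:E <= f e) ->
  (forall a : R, L < a%:E -> \forall e \near 0%R^'+, f e <= a%:E) ->
  f @ 0%R^'+ --> L.
Proof.
case: L => [l| |] lo up A /=.
- rewrite /nbhs/= => -[r /= r0 rA].
  have r2 : (0 < r / 2)%R by rewrite divr_gt0.
  have lo' := lo (l - r / 2)%R; have up' := up (l + r / 2)%R.
  rewrite lte_fin in lo'; rewrite lte_fin in up'.
  have {}lo' := lo' ltac:(lra); have {}up' := up' ltac:(lra).
  near=> e.
  have : (l - r / 2)%:E <= f e by near: e.
  have : f e <= (l + r / 2)%:E by near: e.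
  case E : (f e) => [u| |] //; rewrite !lee_fin => u1 u2.
  by rewrite /= E; apply: rA => /=; rewrite ltr_distlC; apply/andP; split; lra.
- rewrite /nbhs/= => -[M [_ MA]].
  have lo' := lo (M + 1)%R (ltry _).
  near=> e; apply: MA; apply: (@lt_le_trans _ _ (M + 1)%:E).
    by rewrite lte_fin; lra.
  by near: e.
- rewrite /nbhs/= => -[M [_ MA]].
  have up' := up (M - 1)%R (ltNyr _).
  near=> e; apply: MA; apply: (@le_lt_trans _ _ (M - 1)%:E).
    by near: e.
  by rewrite lte_fin; lra.
Unshelve. all: by end_near. Qed.

(** Of the four [del], two are spent on passing from fractional to genuine covers and two on the
    lower bound for the local pressure. *)
Lemma ereal_gap (R : realType) (a : R) (L : \bar R) : a%:E < L ->
  exists2 del : R, (0 < del)%R & (a + 4 * del)%:E < L.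
Proof.
case: L => [l| |] //; last by move=> _; exists 1%R; rewrite ?ltry.
rewrite lte_fin => al; exists ((l - a) / 5)%R; first by rewrite divr_gt0// subr_gt0.
by rewrite lte_fin; lra.
Qed.

Section variational_principle.
Context {R : realType} {d : measure_display} {X : measurableType d}
  {dist : X -> X -> R} {T : X -> X} {Phi : nat -> X -> R} {Z : set X}.
Hypotheses (metricX : is_metric dist) (borelX : borel_for dist)
  (cX : dcompact dist setT) (contT : dcontinuous dist T)
  (contPhi : forall n, dcontinuous_real dist (Phi n)) (cZ : dcompact dist Z).

Let measurable_nball n x e : measurable (nball dist T n x e).
Proof. by apply: (dopen_measurable borelX); exact: nball_dopen. Qed.

(** * Local pressure compared with the critical value *)

Section local_pressure.
Variable mu : probability X R.

(** Otherwise, for some [s] with vanishing cost, a set [C N] of positive measure has all its balls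
    of scale [e / 2] and length at least [N] bounded by the rate [s]. A ball of scale [e] meeting
    [C N] at [y] lies in the ball of scale [e / 2] around [y], so its trace on [C N] has measure at
    most its cost, and no cover of [Z] can be cheaper than [mu (C N)]. *)
Lemma lowerBK_le_Mcrit e : mu Z = 1 -> (0 < e)%R ->
  lowerBK dist T Phi mu (e / 2) <= Mcrit dist T Phi Z e.
Proof.
move=> muZ e0; rewrite leNgt; apply/negP.
move=> /ereal_inf_lt[_ [s Mss <-]] sBK.
have mf := measurable_lowerBK_at metricX borelX contT contPhi mu (e / 2).
have mass := integral_gt_measure mf sBK.
have mZ := dcompact_measurable metricX borelX cZ.
pose u n x := (- lne (mu (nball dist T n x (e / 2))) + (Phi n x)%:E) * (n%:R^-1)%:E.
pose C N := Z `&` \bigcap_(n in [set n | (N <= n)%N]) [set x | s%:E < u n x].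
have mC N : measurable (C N).
  apply: measurableI => //; apply: bigcap_measurableType => n _.
  rewrite -[X in measurable X]setTI; apply: emeasurable_fun_o_infty => //.
  exact: measurable_local_rate.
have [N1 N1P] : exists N, 0 < mu (C N).
  apply: contrapT => nC; move: mass; apply/negP; rewrite -leNgt.
  have muZC : mu (~` Z) = 0 by rewrite probability_setC// muZ subee.
  have mU : measurable (\bigcup_N C N) by exact: bigcup_measurable.
  apply: (@le_trans _ _ (mu (\bigcup_N C N `|` ~` Z))).
    apply: le_measure; rewrite ?inE.
    - by rewrite -[X in measurable X]setTI; exact: emeasurable_fun_o_infty.
    - by apply: measurableU => //; exact: measurableC.
    move=> x /= /limn_einf_gtP[N NP]; have [Zx|] := pselect (Z x); last by right.
    by left; exists N => //; split => // n; exact: NP.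
  have mCZ : measurable (~` Z) by exact: measurableC.
  apply: (@le_trans _ _ (mu (\bigcup_N C N) + mu (~` Z))); first exact: measureU2.
  rewrite muZC adde0.
  apply: (@le_trans _ _ (\sum_(N <oo) mu (C N))).
    exact: measure_sigma_subadditive.
  rewrite eseries0// => N _ _; apply/eqP; rewrite eq_le measure_ge0 andbT leNgt.
  by apply/negP => CN; apply: nC; exists N.
have [N2 N2P] := expRN_double e0.
(* The successor keeps all lengths positive, as division by the length requires. *)
pose N := (N1 + N2).+1.
have CN : 0 < mu (C N).
  apply: lt_le_trans N1P _; apply: le_measure; rewrite ?inE//.
  by move=> x [Zx Cx]; split=> // n /= Nn; apply: Cx => /=; lia.
(* Rewriting 0 as the covering cost at [N] yields a cover that costs less than [mu (C N)]. *)
have /Ms_eq0 /(_ N) MN0 := Mss; move: CN; rewrite -MN0.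
move=> /ereal_inf_lt[_ [I [n [x [nN ZI ->]]]]]; apply/negP; rewrite -leNgt.
rewrite -[leRHS]mul1e.
apply: (measure_le_esum (b := fun i => nball dist T (n i) (x i) e `&` C N)) => //.
- by move=> i _; exact: measurableI.
- by move=> y [Zy Cy]; have [i Ii iy] := ZI y Zy; exists i.
- by move=> i _; exact: expeR_ge0.
move=> i Ii; rewrite mul1e (ctermE metricX cX contPhi).
have [[y [xy [Zy Cy]]]|nb] := pselect (nball dist T (n i) (x i) e `&` C N !=set0); last first.
  have -> : nball dist T (n i) (x i) e `&` C N = set0.
    by apply/seteqP; split => // y ?; apply: nb; exists y.
  by rewrite measure0 lee_fin rcterm_ge0.
have Nn := nN i Ii; have ni0 : (0 < n i)%N by lia.
apply: (@le_trans _ _ (mu (nball dist T (n i) y (e / 2)))).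
  apply: le_measure; rewrite ?inE//; first exact: measurableI.
  by move=> z [xz _]; apply: nball_tri xy xz => //; apply: N2P; lia.
apply: le_trans (local_rate_gt ni0 _ (Cy (n i) Nn)) _ => //.
by rewrite lee_fin; apply: rcterm_ge.
Qed.

(** One [del] pays for replacing the supremum over the ball by the value at its center, the other
    for the constant, since [c <= exp (n del)] for large [n]. *)
Lemma lowerBK_ge e s del (N0 N : nat) (c : R) : (0 < c)%R -> (0 < del)%R ->
  distortion_le dist T Phi e del N0 ->
  (forall n x, (N <= n)%N -> mu (nball dist T n x e) <= (c * rcterm dist T Phi s n x e)%:E) ->
  (s - 2 * del)%:E <= lowerBK dist T Phi mu e.
Proof.
move=> c0 del0 dis muB; apply: integral_ge_cst => [|x].
  exact: measurable_lowerBK_at.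
have ci0 : (0 < c^-1)%R by rewrite invr_gt0.
have [N1 N1P] := expRN_small ci0 del0.
apply: (@limn_einf_ge _ _ _ (N0 + N + N1).+1) => n Nn.
apply: local_rate_ge => //; first by lia.
apply: le_trans (muB _ _ _) _; first by lia.
rewrite lee_fin; apply: (@le_trans _ _ (c * expR (- (n%:R * s) + (Phi n x + n%:R * del)))%R).
  rewrite ler_pM2l//; apply: rcterm_le => // y /(dis _ _ _ _).
  have N0n : (N0 <= n)%N by lia.
  by move=> /(_ N0n); rewrite distrC => /ler_normlW; lra.
have -> : (- (n%:R * (s - 2 * del)) + Phi n x =
    (- (n%:R * s) + (Phi n x + n%:R * del)) + n%:R * del)%R by ring.
rewrite [leRHS]expRD mulrC ler_pM2l ?expR_gt0//.
rewrite -[leLHS]invrK -[leRHS]invrK lef_pV2 ?posrE ?invr_gt0 ?expR_gt0//.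
by rewrite -expRN ltW// N1P//; lia.
Qed.

End local_pressure.

(** * Katok pressure compared with the critical value *)

Section katok_pressure.
Variable mu : probability X R.

Lemma LNs_ge0 del N e s : 0 <= LNs dist T Phi mu del N e s.
Proof.
apply: le_ereal_inf_tmp => _ [I [n [x [_ _ ->]]]].
by apply: esum_ge0 => i _; exact: expeR_ge0.
Qed.

Lemma Ls_eq0 del e s : Ls dist T Phi mu del e s = 0 <->
  forall N, LNs dist T Phi mu del N e s = 0.
Proof.
apply: limn_nondecreasing_eq0; first by move=> N; exact: LNs_ge0.
move=> N N' NN'; apply: ereal_inf_le_tmp => _ [I [n [x [nN ZI ->]]]].
by exists I, n, x; split=> // i /nN; exact: leq_trans.
Qed.

Lemma Lcrit_nonincreasing e del del' : (del <= del')%R ->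
  Lcrit dist T Phi mu e del' <= Lcrit dist T Phi mu e del.
Proof.
move=> dd; apply: ereal_inf_le_tmp => _ [s /= /Ls_eq0 Ls0 <-].
exists s => //=; apply/Ls_eq0 => N; apply/eqP; rewrite eq_le LNs_ge0 andbT.
rewrite -(Ls0 N); apply: ereal_inf_le_tmp => _ [I [n [x [nN ZI ->]]]].
exists I, n, x; split=> //; apply: le_lt_trans ZI.
by rewrite lee_fin lerD2l lerN2.
Qed.

(** A smaller [delta] leaves fewer admissible families, so the limit at 0 is a monotone one. *)
Lemma PK_sup e : PK dist T Phi mu e =
  ereal_sup (Lcrit dist T Phi mu e @` `]0%R, 1%R[%classic).
Proof.
apply/cvg_lim => //.
apply: (nonincreasing_at_right_cvge (BLeft 1%R)) => [|x y _ _].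
  by rewrite bnd_simp.
exact: Lcrit_nonincreasing.
Qed.

Lemma PK_le_Mcrit e : mu Z = 1 ->
  PK dist T Phi mu e <= Mcrit dist T Phi Z e.
Proof.
move=> muZ; rewrite PK_sup; apply: ge_ereal_sup => _ [del /= + <-].
rewrite in_itv/= => /andP[del0 _].
apply: ereal_inf_le_tmp => _ [s /= /Ms_eq0 Ms0 <-].
exists s => //=; apply/Ls_eq0 => N; apply/eqP; rewrite eq_le LNs_ge0 andbT.
rewrite -(Ms0 N); apply: ereal_inf_le_tmp => _ [I [n [x [nN ZI ->]]]].
exists I, n, x; split=> //.
apply: (@lt_le_trans _ _ (mu Z)); first by rewrite muZ lte_fin; lra.
apply: le_measure; rewrite ?inE//; first exact: (dcompact_measurable metricX).
exact: bigcup_measurable.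
Qed.

(** At [delta = 1 / 2] a family carrying more than half the mass costs at least [c^-1 / 2] for any
    exponent below [s], so the cost cannot vanish there. *)
Lemma PK_ge e s N (c : R) : (0 < c)%R ->
  (forall n x, (N <= n)%N -> mu (nball dist T n x e) <= (c * rcterm dist T Phi s n x e)%:E) ->
  s%:E <= PK dist T Phi mu e.
Proof.
move=> c0 muB; rewrite PK_sup; apply: (@le_trans _ _ (Lcrit dist T Phi mu e 2^-1)).
  apply: le_ereal_inf_tmp => _ [s' /= /Ls_eq0 /(_ N) Ls0 <-].
  rewrite lee_fin leNgt; apply/negP => s's.
  have : LNs dist T Phi mu 2^-1 N e s' < (c^-1 * 2^-1)%:E.
    by rewrite Ls0 lte_fin mulr_gt0// invr_gt0.
  move=> /ereal_inf_lt[_ [I [n [x [nN muI ->]]]]]; apply/negP; rewrite -leNgt.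
  rewrite EFinM lee_pdivrMl// -[leLHS]/((2^-1)%:E).
  have -> : (2^-1 = 1 - 2^-1 :> R)%R by lra.
  apply: le_trans (ltW muI) _.
  apply: (measure_le_esum (b := fun i => nball dist T (n i) (x i) e)).
  - by apply: bigcup_measurable.
  - by move=> i _; exact: measurable_nball.
  - by [].
  - by move=> i _; exact: expeR_ge0.
  - exact: ltW.
  move=> i Ii; apply: le_trans (muB _ _ (nN i Ii)) _.
  rewrite (ctermE metricX cX contPhi) -EFinM lee_fin ler_pM2l//.
  by apply: rcterm_anti; exact: ltW.
apply: ereal_sup_ubound; exists 2^-1%R => //=; rewrite in_itv/=.
by apply/andP; split; lra.
Qed.

End katok_pressure.

(** A smaller scale means larger balls, so centers and lengths are kept. On the larger ball the
    potential exceeds its value at the center by at most [n del], which raising the exponent by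
    [del] compensates. *)
Lemma Mcrit_mono e1 e2 del N0 : (e1 <= e2)%R ->
  distortion_le dist T Phi e1 del N0 ->
  Mcrit dist T Phi Z e1 <= Mcrit dist T Phi Z e2 + del%:E.
Proof.
move=> e12 dis; rewrite -leeBlDr//.
apply: le_ereal_inf_tmp => _ [s /Ms_eq0 Ms0 <-].
rewrite leeBlDr// -EFinD; apply: ereal_inf_lbound; exists (s + del)%R => //=.
apply/Ms_eq0 => N; apply/eqP; rewrite eq_le MNs_ge0 andbT -(Ms0 (N0 + N)%N).
apply: le_ereal_inf_tmp => _ [I [n [x [nN ZI ->]]]].
apply: (@le_trans _ _ (\esum_(i in I) cterm dist T Phi (s + del) (n i) (x i) e1)).
  apply: ereal_inf_lbound; exists I, n, x; split=> //.
    by move=> i /nN; lia.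
  by move=> z /ZI[i Ii iz]; exists i => //; exact: nballS iz.
apply: le_esum => i Ii; rewrite !(ctermE metricX cX contPhi) lee_fin.
have cen : nball dist T (n i) (x i) e2 (x i) by exact: nball_center.
apply: le_trans (rcterm_ge metricX cX contPhi s cen).
apply: le_trans (rcterm_le (c := (Phi (n i) (x i) + (n i)%:R * del)%R) metricX cX contPhi _ _) _.
  have N0n : (N0 <= n i)%N by have := nN i Ii; lia.
  by move=> y /(dis _ _ _ N0n); rewrite distrC => /ler_normlW; lra.
by rewrite ler_expR; lra.
Qed.

(** * Limits as the scale tends to zero *)

Hypothesis temp : tempered_distortion dist T Phi.

Let L := ereal_inf [set Mcrit dist T Phi Z e | e in [set e : R | (0 < e)%R]].

Lemma Mcrit_cvg : Mcrit dist T Phi Z @ 0%R^'+ --> L.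
Proof.
apply: cvge_at_right0 => a.
  move=> aL; apply/at_right0P; exists 1%R => // e e0 _.
  by apply: le_trans (ltW aL) _; apply: ereal_inf_lbound; exists e.
move=> /ereal_inf_lt[_ [e2 /= e20 <-] Ma].
(* The critical value may be [-oo], and then any positive [del] will do. *)
have [del del0 Md] : exists2 del : R, (0 < del)%R &
    Mcrit dist T Phi Z e2 + del%:E <= a%:E.
  case: (Mcrit _ _ _ _ _) Ma => [r| |] //; last first.
    by move=> _; exists 1%R => //; rewrite addNye leNye.
  by rewrite lte_fin => ra; exists (a - r)%R; rewrite ?subr_gt0// -EFinD lee_fin; lra.
have [e0 e00 h] := tempered_distortion_le temp del0.
apply/at_right0P; exists (Num.min e0 e2); first by rewrite lt_min e00.
move=> e e_gt0; rewrite lt_min => /andP[ee0 ee2].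
have [N dis] := h e e_gt0 ee0.
by apply: le_trans Md; apply: Mcrit_mono dis; exact: ltW.
Qed.

Lemma PB_inf : PB dist T Phi Z = L.
Proof. by apply/cvg_lim => //; exact: Mcrit_cvg. Qed.

Lemma Mcrit_near (a : R) : L < a%:E ->
  \forall e \near 0%R^'+, Mcrit dist T Phi Z e <= a%:E.
Proof.
move=> La; have : ereal_nbhs L (fun u => u < a%:E) by exact: open_ereal_lt'.
move=> /Mcrit_cvg /at_right0P[e0 e00 h]; apply/at_right0P; exists e0 => // e e_gt0 ee0.
exact/ltW/h.
Qed.

Lemma frostman_near (a : R) : a%:E < L -> exists2 del : R, (0 < del)%R &
  \forall e \near 0%R^'+, (exists N, distortion_le dist T Phi e del N) /\
    exists mu : probability X R, exists N, exists c : R,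
    [/\ mu Z = 1, (0 < c)%R & forall n x, (N <= n)%N -> mu (nball dist T n x e) <=
      (c * rcterm dist T Phi (a + 2 * del) n x e)%:E].
Proof.
move=> /ereal_gap[del del0 aL]; exists del => //.
have [e0 e00 h] := tempered_distortion_le temp del0.
apply/at_right0P; exists e0 => // e e_gt0 ee0.
have e20 : (0 < e / 2)%R by rewrite divr_gt0.
have e2e0 : (e / 2 < e0)%R by lra.
split; first exact: h.
have [N dis] := h _ e20 e2e0.
apply: (frostman_below_Mcrit metricX cX contT contPhi borelX cZ e_gt0 del0 dis).
have -> : (a + 2 * del + 2 * del = a + 4 * del)%R by ring.
by apply: lt_le_trans aL _; apply: ereal_inf_lbound; exists (e / 2)%R.
Qed.

Lemma sup_lowerBK_cvg : (fun eps : R => ereal_sup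
    [set lowerBK dist T Phi mu eps | mu in [set mu : probability X R | mu Z = 1]])
  @ 0%R^'+ --> L.
Proof.
apply: cvge_at_right0 => a.
  move=> /frostman_near[del del0 /at_right0P[e0 e00 h]].
  apply/at_right0P; exists e0 => // e e_gt0 ee0.
  have [[N0 dis] [mu [N [c [muZ c0 muB]]]]] := h e e_gt0 ee0.
  apply: (@le_trans _ _ (lowerBK dist T Phi mu e)); last first.
    by apply: ereal_sup_ubound; exists mu.
  by have := lowerBK_ge c0 del0 dis muB; rewrite addrK.
move=> /Mcrit_near /at_right0P[e0 e00 h].
(* The local pressure at scale [e] is compared with the critical value at [2 e], which must stay
   below [e0]. *)
apply/at_right0P; exists (e0 / 2)%R; first by rewrite divr_gt0.
move=> e e_gt0 ee0; apply: ge_ereal_sup => _ [mu muZ <-].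
have e2 : (0 < 2 * e)%R by lra.
have -> : (e = 2 * e / 2)%R by field.
apply: le_trans (lowerBK_le_Mcrit muZ e2) _.
by apply: h => //; lra.
Qed.

Lemma sup_PK_cvg : (fun eps : R => ereal_sup
    [set PK dist T Phi mu eps | mu in [set mu : probability X R | mu Z = 1]])
  @ 0%R^'+ --> L.
Proof.
apply: cvge_at_right0 => a.
  move=> /frostman_near[del del0 /at_right0P[e0 e00 h]].
  apply/at_right0P; exists e0 => // e e_gt0 ee0.
  have [_ [mu [N [c [muZ c0 muB]]]]] := h e e_gt0 ee0.
  apply: (@le_trans _ _ (PK dist T Phi mu e)); last first.
    by apply: ereal_sup_ubound; exists mu.
  apply: le_trans (PK_ge c0 muB); rewrite lee_fin; lra.
move=> /Mcrit_near /at_right0P[e0 e00 h].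
apply/at_right0P; exists e0 => // e e_gt0 ee0.
apply: ge_ereal_sup => _ [mu muZ <-].
by apply: le_trans (PK_le_Mcrit _ muZ) _; exact: h.
Qed.

End variational_principle.

Theorem mainTheorem1 (R : realType) (d : measure_display) (X : measurableType d)
  (dist : X -> X -> R) (T : X -> X) (Phi : nat -> X -> R) (Z : set X) :
  is_metric dist ->
  borel_for dist ->
  dcompact dist setT ->
  dcontinuous dist T ->
  (forall n, dcontinuous_real dist (Phi n)) ->
  dcompact dist Z ->
  Z !=set0 ->
  tempered_distortion dist T Phi ->
  ((fun eps : R => ereal_sup
      [set lowerBK dist T Phi mu eps | mu in [set mu : probability X R | mu Z = 1]])
     @ 0^'+ --> PB dist T Phi Z) /\
  ((fun eps : R => ereal_sup
      [set PK dist T Phi mu eps | mu in [set mu : probability X R | mu Z = 1]])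
     @ 0^'+ --> PB dist T Phi Z).
Proof.
move=> metricX borelX cX contT contPhi cZ _ temp.
rewrite PB_inf//; split; first exact: sup_lowerBK_cvg.
exact: sup_PK_cvg.
Qed.
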